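(* Let $s>2$ be a prime power and $n$ a positive integer. The column juxtaposition of $H(X_1,\dots,X_n)$ and $Q_1^*(X_1,\dots,X_n)$ (evaluated at all points of $F_s^n$) forms an $SSD(s^n,s^m)$ with $m=2(s^n-1)/(s-1)-1$. It has overall $A_2=s^n-s$ and is optimal under GMA. Furthermore, column $X_1$ is orthogonal to all other columns and there are no fully aliased columns if $s>2$. (i) For $s$ odd, the possible projected $A_2$ values are $0$ and $(s-1)/s$. There are $s(s^n-s)/(s-1)$ pairs of semi-orthogonal columns with projected $A_2=(s-1)/s$. (ii) For $s$ even, the possible projected $A_2$ values are $0$ and $1$. There are $s^n-s$ pairs of semi-orthogonal columns with projected $A_2=1$.
   Context: Designs: $SSD(N,s^m)$ denotes an $N\times m$ matrix $D=[x_{ik}]$ with entries in a set of $s$ symbols (here the finite field $F_s$ with $s$ elements), which is balanced: in every column each symbol appears exactly $N/s$ times. Generalized wordlength pattern: choose orthonormal contrasts on the symbol set, i.e. complex-valued functions $c_1,\dots,c_{s-1}$ on the symbols with $\sum_x c_a(x)=0$ and $\sum_x c_a(x)\overline{c_b(x)}=s$ if $a=b$ and $0$ otherwise. For $j=1,\dots,m$, $$A_j(D)=N^{-2}\sum_{K\subseteq\{1,\dots,m\},\,|K|=j}\ \sum_{(a_k)_{k\in K}\in\{1,\dots,s-1\}^K}\Big|\sum_{i=1}^N\prod_{k\in K}c_{a_k}(x_{ik})\Big|^2 ,$$ independently of the choice of contrasts. The overall $A_2$ is $A_2(D)$; the projected $A_2$ value of a pair of columns is $A_2$ of the two-column design they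 form. $D$ is optimal under GMA (generalized minimum aberration) if there is no $SSD(N,s^m)$ $D'$ and index $r$ with $A_j(D')=A_j(D)$ for all $j<r$ and $A_r(D')<A_r(D)$. Polynomial columns: a function $f(X_1,\dots,X_n)$ on $F_s^n$ gives a column of length $s^n$, rows being indexed by the points of $F_s^n$; a set of functions gives the design with the corresponding columns. $H(X_1,\dots,X_n)$ is the set of nonzero linear forms $c_1X_1+\cdots+c_nX_n$ ($c_i\in F_s$) whose last nonzero coefficient is $1$; similarly $H(X_2,\dots,X_n)$ in the variables $X_2,\dots,X_n$. $Q_1^*(X_1,\dots,X_n)=\{X_1^2+aX_1+h: a\in F_s,\ h\in H(X_2,\dots,X_n)\}$. Pairs of columns of length $s^n$: fully aliased if the pair has only $s$ distinct level combinations, each occurring $s^{n-1}$ times; orthogonal if it has $s^2$ distinct level combinations, each occurring $s^{n-2}$ times; semi-orthogonal if, for $s$ odd, it has $(s+1)s/2$ distinct level combinations, $s$ of them occurring $s^{n-2}$ times and $s(s-1)/2$ of them occurring $2s^{n-2}$ times, and, for $s$ even, it has $s^2/2$ distinct level combinations each occurring $2s^{n-2}$ times. *)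

(* Defs.v *)
From HB Require Import structures.
From mathcomp Require Import all_boot all_order all_algebra.
From mathcomp Require Import reals complex.

Set Implicit Arguments.
Unset Strict Implicit.
Unset Printing Implicit Defensive.

Import Order.TTheory GRing.Theory Num.Theory.
Local Open Scope ring_scope.

Section Designs.
Variable S : finType.

Definition balanced (N m : nat) (D : 'M[S]_(N, m)) : Prop :=
  forall (k : 'I_m) (x : S), (#|[set i | D i k == x]| * #|S|)%N = N.

(* The sizes of D are kept apart from N, s and m, so that "D is an
   SSD(N, s^m)" also asserts that D has these sizes. *)
Definition is_SSD (N s m : nat) (N' m' : nat) (D : 'M[S]_(N', m')) : Prop :=
  [/\ N' = N, #|S| = s, m' = m & balanced D].

Section Wordlength.
Variable R : realType.

Definition orthonormal_contrasts (c : 'I_(#|S|.-1) -> S -> R[i]) : Prop :=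
  (forall a, \sum_x c a x = 0) /\
  (forall a b, \sum_x c a x * (c b x)^* = if a == b then #|S|%:R else 0).

(* The values are nonnegative reals inside R[i]; there the partial order of
   R[i] restricts to the usual order. *)
Definition gwp (c : 'I_(#|S|.-1) -> S -> R[i]) (N m : nat)
    (D : 'M[S]_(N, m)) (j : nat) : R[i] :=
  (N%:R ^- 2) *
  \sum_(K : {set 'I_m} | #|K| == j)
    \sum_(a : {ffun {k : 'I_m | k \in K} -> 'I_(#|S|.-1)})
      `| \sum_(i < N) \prod_(k : {k : 'I_m | k \in K}) c (a k) (D i (val k)) |
        ^+ 2.

Definition projected_A2 (c : 'I_(#|S|.-1) -> S -> R[i]) (N m : nat)
    (D : 'M[S]_(N, m)) (k l : 'I_m) : R[i] :=
  gwp c (row_mx (col k D) (col l D)) 2.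

Definition GMA_optimal (c : 'I_(#|S|.-1) -> S -> R[i]) (N m : nat)
    (D : 'M[S]_(N, m)) : Prop :=
  ~ exists (D' : 'M[S]_(N, m)) (r : nat),
      [/\ is_SSD N #|S| m D', (1 <= r <= m)%N,
          forall j : nat, (1 <= j < r)%N -> gwp c D' j = gwp c D j
        & gwp c D' r < gwp c D r].

End Wordlength.

Section Pairs.
Variables (N m : nat) (D : 'M[S]_(N, m)).

Definition occurrences (k l : 'I_m) (p : S * S) : nat :=
  #|[set i | (D i k, D i l) == p]|.

Definition level_combinations (k l : 'I_m) : {set S * S} :=
  [set p | (0 < occurrences k l p)%N].

(* In the next three definitions the columns have length s ^ n, where s is
   the number of symbols.  For n = 1 the exponent n - 2 is truncated to 0. *)
Definition fully_aliased (n : nat) (k l : 'I_m) : bool :=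
  (#|level_combinations k l| == #|S|) &&
  [forall p in level_combinations k l,
     occurrences k l p == (#|S| ^ (n - 1))%N].

Definition orthogonal_cols (n : nat) (k l : 'I_m) : bool :=
  (#|level_combinations k l| == #|S| ^ 2)%N &&
  [forall p in level_combinations k l,
     occurrences k l p == (#|S| ^ (n - 2))%N].

Definition semi_orthogonal (n : nat) (k l : 'I_m) : bool :=
  let L := level_combinations k l in
  if odd #|S| then
    [&& #|L| == ((#|S| + 1) * #|S|) %/ 2,
        #|[set p in L | occurrences k l p == #|S| ^ (n - 2)]| == #|S|
      & #|[set p in L | occurrences k l p == 2 * #|S| ^ (n - 2)]|
          == (#|S| * (#|S| - 1)) %/ 2]%N
  else
    (#|L| == (#|S| ^ 2) %/ 2)%N &&
    [forall p in L, occurrences k l p == (2 * #|S| ^ (n - 2))%N].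

(* Unordered pairs of distinct columns, each listed once with k < l. *)
Definition semi_orthogonal_pairs (n : nat) : {set 'I_m * 'I_m} :=
  [set p : 'I_m * 'I_m | (p.1 < p.2)%N && semi_orthogonal n p.1 p.2].

End Pairs.
End Designs.

Section PolynomialColumns.
Variables (F : finFieldType) (n : nat).

Definition linear_form (c : 'rV[F]_n) : {ffun 'rV[F]_n -> F} :=
  [ffun x : 'rV[F]_n => \sum_(k < n) c 0 k * x 0 k].

(* lin_forms j is H(X_(j+1), ..., X_n); the variable X_k is the coordinate of
   index k - 1. *)
Definition lin_forms (j : nat) : {set {ffun 'rV[F]_n -> F}} :=
  [set linear_form c | c : 'rV[F]_n &
     [forall k : 'I_n, (k < j)%N ==> (c 0 k == 0)] &&
     [exists k : 'I_n, (c 0 k == 1) &&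
        [forall l : 'I_n, (k < l)%N ==> (c 0 l == 0)]]].

Definition X1 (hn : (0 < n)%N) : {ffun 'rV[F]_n -> F} :=
  [ffun x : 'rV[F]_n => x 0 (Ordinal hn)].

Definition Q1star (hn : (0 < n)%N) : {set {ffun 'rV[F]_n -> F}} :=
  [set [ffun x : 'rV[F]_n => X1 hn x ^+ 2 + a * X1 hn x + (h : {ffun 'rV[F]_n -> F}) x]
     | a in [set: F], h in lin_forms 1].

(* Row i is the i-th point of F^n, column k the k-th function of A. *)
Definition design_of (A : {set {ffun 'rV[F]_n -> F}}) :
    'M[F]_(#|{: 'rV[F]_n}|, #|A|) :=
  \matrix_(i, k) (enum_val k : {ffun 'rV[F]_n -> F}) (enum_val i).

Definition HQ_design (hn : (0 < n)%N) :
    'M[F]_(#|{: 'rV[F]_n}|, #|lin_forms 0| + #|Q1star hn|) :=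
  row_mx (design_of (lin_forms 0)) (design_of (Q1star hn)).

End PolynomialColumns.

(* Main.v *)
Require Import Defs.
From HB Require Import structures.
From mathcomp Require Import all_boot all_order all_algebra.
From mathcomp Require Import reals complex.
From mathcomp Require Import finfield ring zify.

Set Implicit Arguments.
Unset Strict Implicit.
Unset Printing Implicit Defensive.

Import Order.TTheory GRing.Theory Num.Theory.
Local Open Scope ring_scope.

(** Write q for the number of elements of the field, N = q^n for the number of
    rows, and call the number of columns in which two rows agree their number of
    coincidences.

    Orthonormality of the contrasts gives a dual orthogonality relation, by which
    each A_j is the average, over all ordered pairs of rows, of a Krawtchouk number
    depending only on the number of coincidences ([gwp_coincidences]).  In a
    balanced design the total number of coincidences is fixed, so that A_1 = 0 and
    A_2 is an increasing affine function of the sum of squares of the coincidences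
    ([gwp2_coincidences]).  That sum is smallest when the coincidences of distinct
    rows take only two consecutive values, and then their distribution is forced:
    a balanced design with the same A_2 has the same A_j for every j.  So a
    balanced design with this property is optimal ([near_const_GMA_optimal]).

    Let a be the number of normalised linear forms in X_2, ..., X_n.  At two
    distinct points the linear columns agree a times.  If the points differ in
    X_1, each form h has exactly one coefficient of X_1 for which the quadratic
    columns agree, which gives a more coincidences; otherwise the quadratic columns
    agree a - 1 times in all.  Hence the coincidences are 2a or 2a - 1
    ([coincidences_HQ_design]), which yields optimality and the value of A_2.

    For a pair of columns f, g one looks for a translation that fixes f and runs g
    through all its values; it exists, up to a change of the pair, unless
    f = c_1 X_1 + h and g = X_1^2 + a X_1 + h with the same h.  In that case
    (f, g) = (u, v) has q^n / q^2 solutions for each root t of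
    t^2 + (a - c_1) t = v - u ([joint_aligned]).  Counting quadratics with one or
    two roots shows that the pair is semi-orthogonal, except that for q even and
    a = c_1 squaring is a bijection and the pair is orthogonal.  The projected A_2
    is computed from the joint frequencies ([projected_A2_occurrences]), and the
    semi-orthogonal pairs are counted by the triples (c_1, a, h). *)

(** * Wordlength patterns and coincidences of rows *)

(** The number of columns in which rows [i] and [i'] agree. *)
Definition coincidences (S : finType) (N m : nat) (D : 'M[S]_(N, m))
    (i i' : 'I_N) : nat := #|[set k | D i k == D i' k]|.

(** [kraw s m d j] is the coefficient of X^j in
    (1 + (s - 1) X)^d (1 - X)^(m - d), a Krawtchouk number. *)
Definition kraw (C : comNzRingType) (s m d j : nat) : C :=
  ((1 + (s%:R - 1)%:P * 'X) ^+ d * (1 + (-1)%:P * 'X) ^+ (m - d) : {poly C})`_j.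

(** A row of contrasts extended by the constant function is a square matrix
    that is unitary up to the factor #|S|, hence so is its transpose. *)
Lemma contrasts_dual (S : finType) (R : realType)
    (c : 'I_(#|S|.-1) -> S -> R[i]) :
  orthonormal_contrasts c -> forall x y : S,
  \sum_a c a x * (c a y)^* = #|S|%:R * (x == y)%:R - 1.
Proof.
move=> [c0 c1] x y.
have S_gt0 : (0 < #|S|)%N by apply/card_gt0P; exists x.
set p := #|S|.-1 in c c0 c1 *.
have Sp : p.+1 = #|S| by rewrite /p prednK.
pose e (j : 'I_p.+1) : S := enum_val (cast_ord Sp j).
pose e' (z : S) : 'I_p.+1 := cast_ord (esym Sp) (enum_rank z).
have eK : cancel e e' by move=> j; rewrite /e /e' enum_valK cast_ordK.
have e'K : cancel e' e by move=> z; rewrite /e /e' cast_ordKV enum_rankK.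
have e'_bij : bijective e' by exists e.
pose cc (k : 'I_p.+1) (z : S) : R[i] :=
  if unlift ord0 k is Some a then c a z else 1.
pose A : 'M[R[i]]_p.+1 := \matrix_(k, j) cc k (e j).
pose B : 'M[R[i]]_p.+1 := \matrix_(j, k) (#|S|%:R^-1 * (cc k (e j))^*).
have S_neq0 : (#|S|%:R : R[i]) != 0 by rewrite pnatr_eq0 -lt0n.
have cc_orth (k l : 'I_p.+1) :
  \sum_z cc k z * (cc l z)^* = #|S|%:R * (k == l)%:R.
  rewrite /cc; case: (unliftP ord0 k) => [a|] ->; case: (unliftP ord0 l) => [b|] ->.
  - rewrite (inj_eq lift_inj) c1; case: (a == b); rewrite ?mulr1 ?mulr0 //.
  - under eq_bigr do rewrite rmorph1 mulr1.
    by rewrite c0 eq_sym (negbTE (neq_lift _ _)) mulr0.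
  - under eq_bigr do rewrite mul1r.
    rewrite -rmorph_sum c0 rmorph0.
    by rewrite (negbTE (neq_lift _ _)) mulr0.
  - under eq_bigr do rewrite rmorph1 mulr1.
    by rewrite eqxx mulr1 sumr_const.
(* Orthonormality says that B is a right inverse of A; it is a left inverse too. *)
have AB : A *m B = 1%:M.
  apply/matrixP => k l; rewrite !mxE.
  transitivity (#|S|%:R^-1 * \sum_z cc k z * (cc l z)^*).
    rewrite mulr_sumr [RHS](reindex e) /=; last exact/onW_bij/(Bijective eK e'K).
    by apply: eq_bigr => j _; rewrite !mxE mulrCA.
  by rewrite cc_orth mulrA mulVf // mul1r.
have /matrixP/(_ (e' y) (e' x)) := mulmx1C AB.
rewrite !mxE big_ord_recl !mxE !e'K (inj_eq (bij_inj e'_bij)).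
rewrite {1 2}/cc unlift_none rmorph1 !mulr1 => E.
have -> : \sum_a c a x * (c a y)^* =
    #|S|%:R * \sum_(i < p) B (e' y) (lift ord0 i) * A (lift ord0 i) (e' x).
  rewrite mulr_sumr; apply: eq_bigr => a _.
  by rewrite !mxE !e'K /cc liftK mulrA mulrA mulfV // mul1r mulrC.
apply: (mulfI (invr_neq0 S_neq0)).
by rewrite mulrBr !mulrA mulVf // !mul1r mulr1 [x == y]eq_sym -E addrC addKr.
Qed.

Lemma sum_subsets_coef (C : comNzRingType) (m j : nat) (w : 'I_m -> C) :
  \sum_(K : {set 'I_m} | #|K| == j) \prod_(k in K) w k =
  (\prod_k (1 + (w k)%:P * 'X))`_j.
Proof.
under eq_bigr do rewrite addrC.
rewrite bigA_distr coef_sum /=.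
rewrite [RHS](bigID (fun K : {set 'I_m} => #|K| == j)) /=.
have coefK (K : {set 'I_m}) :
    (\prod_i (if i \in K then (w i)%:P * 'X else 1) : {poly C}) =
    (\prod_(k in K) w k)%:P * 'X^#|K|.
  rewrite -big_mkcond big_split /= -rmorph_prod; congr (_ * _).
  by rewrite prodr_const.
rewrite [X in _ = _ + X]big1 ?addr0.
  by apply: eq_bigr => K /eqP <-; rewrite coefK coefCM coefXn eqxx mulr1.
by move=> K nK; rewrite coefK coefCM coefXn eq_sym (negbTE nK) mulr0.
Qed.

(** The form of the MacWilliams identities used below: the wordlength pattern
    depends only on the numbers of coincidences between rows. *)
Lemma gwp_coincidences (S : finType) (R : realType)
    (c : 'I_(#|S|.-1) -> S -> R[i]) (N m : nat) (D : 'M[S]_(N, m)) (j : nat) :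
  orthonormal_contrasts c ->
  gwp c D j = N%:R ^- 2 * \sum_i \sum_i' kraw R[i] #|S| m (coincidences D i i') j.
Proof.
move=> hc; rewrite /gwp; congr (_ * _).
pose w i i' k : R[i] := #|S|%:R * (D i k == D i' k)%:R - 1.
transitivity (\sum_(K : {set 'I_m} | #|K| == j) \sum_i \sum_i' \prod_(k in K) w i i' k).
  apply: eq_bigr => K _.
  transitivity (\sum_(a : {ffun {k : 'I_m | k \in K} -> 'I_(#|S|.-1)})
      \sum_i \sum_i' \prod_(k : {k : 'I_m | k \in K})
        (c (a k) (D i (val k)) * (c (a k) (D i' (val k)))^*)).
    apply: eq_bigr => a _; rewrite normCK rmorph_sum mulr_suml.
    apply: eq_bigr => i _; rewrite mulr_sumr; apply: eq_bigr => i' _.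
    by rewrite rmorph_prod -big_split.
  rewrite exchange_big; apply: eq_bigr => i _ /=.
  rewrite exchange_big; apply: eq_bigr => i' _ /=.
  rewrite -(bigA_distr_bigA (fun (k : {k | k \in K}) a =>
    c a (D i (val k)) * (c a (D i' (val k)))^*)) /=.
  rewrite [RHS]big_sub; apply: eq_bigr => k _.
  exact: contrasts_dual.
rewrite exchange_big; apply: eq_bigr => i _ /=.
rewrite exchange_big; apply: eq_bigr => i' _ /=.
rewrite sum_subsets_coef /kraw; congr (_`_j).
set E := [set k | D i k == D i' k].
have prodE : \prod_(k in E) (1 + (w i i' k)%:P * 'X) =
    (1 + (#|S|%:R - 1)%:P * 'X) ^+ coincidences D i i'.
  rewrite -prodr_const; apply: eq_bigr => k; rewrite inE => Ek.
  by rewrite /w Ek mulr1.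
have prodCE : \prod_(k | k \notin E) (1 + (w i i' k)%:P * 'X) =
    (1 + (-1)%:P * 'X) ^+ (m - coincidences D i i').
  have -> : (m - coincidences D i i')%N = #|~: E|.
    by rewrite cardsCs setCK card_ord.
  rewrite -prodr_const; apply: eq_big => [k|k]; rewrite !inE // => /negbTE Ek.
  by rewrite /w Ek mulr0 sub0r.
by rewrite (bigID (mem E)) /= prodE prodCE.
Qed.

(** Low coefficients of a product of linear factors 1 + wX, through the power
    sums [u] and [v] of the [w]: Newton's identity for j = 2. *)
Definition low_coefs (C : comNzRingType) (P : {poly C}) (u v : C) : Prop :=
  [/\ P`_0 = 1, P`_1 = u & P`_2 *+ 2 = u ^+ 2 - v].

Lemma low_coefsM (C : comNzRingType) (P Q : {poly C}) u v u' v' :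
  low_coefs P u v -> low_coefs Q u' v' -> low_coefs (P * Q) (u + u') (v + v').
Proof.
move=> [P0 P1 P2] [Q0 Q1 Q2]; split.
- by rewrite coefM big_ord1 P0 Q0 mulr1.
- by rewrite coefM !big_ord_recl big_ord0 /= P0 Q0 /bump /= P1 Q1; ring.
- rewrite coefM !big_ord_recl big_ord0 /= /bump /= P0 P1 Q0 Q1.
  have -> : (1 * Q`_2 + (u * u' + (P`_2 * 1 + 0))) *+ 2 =
    P`_2 *+ 2 + Q`_2 *+ 2 + (u * u') *+ 2 by ring.
  by rewrite P2 Q2; ring.
Qed.

Lemma low_coefsX (C : comNzRingType) (w : C) (d : nat) :
  low_coefs ((1 + w%:P * 'X) ^+ d) (d%:R * w) (d%:R * w ^+ 2).
Proof.
elim: d => [|d IH].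
  by rewrite expr0 !mul0r; split; rewrite coef1 //= ?expr0n ?subrr // mul0rn.
have natS x : d.+1%:R * x = x + d%:R * x :> C by rewrite -natr1 mulrDl mul1r addrC.
rewrite exprS !natS; apply: low_coefsM => //.
by split; rewrite coefD coef1 coefCM coefX /= ?mulr0 ?addr0 ?mulr1 ?add0r ?mul0rn ?subrr.
Qed.

Lemma kraw1 (C : comNzRingType) (s m d : nat) : (d <= m)%N ->
  kraw C s m d 1 = s%:R * d%:R - m%:R.
Proof.
rewrite /kraw => dm.
have [_ -> _] := low_coefsM (low_coefsX (s%:R - 1 : C) d) (low_coefsX (-1 : C) (m - d)).
by rewrite natrB //; ring.
Qed.

Lemma kraw2 (C : comNzRingType) (s m d : nat) : (d <= m)%N ->
  kraw C s m d 2 *+ 2 = (s%:R * d%:R - m%:R) ^+ 2 - (s%:R * (s%:R - 2) * d%:R + m%:R).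
Proof.
rewrite /kraw => dm.
have [_ _ ->] := low_coefsM (low_coefsX (s%:R - 1 : C) d) (low_coefsX (-1 : C) (m - d)).
by rewrite natrB //; ring.
Qed.

(** * Balanced designs with nearly constant coincidences *)

(** The next two lemmas rearrange (T - y) (T - 1 - y) >= 0, an equality exactly
    when y is T or T - 1, by means of an x for which it is an equality.  For T = 0
    the truncated 2T - 1 is harmless, since then x = 0. *)
Lemma near_const_leq (T x y : nat) : (x <= T <= x + 1)%N ->
  (x ^ 2 + (2 * T - 1) * y <= y ^ 2 + (2 * T - 1) * x)%N.
Proof.
case: T => [|t] xT; first by have -> : x = 0%N by lia.
have -> : (2 * t.+1 - 1 = 2 * t + 1)%N by lia.
rewrite -!mulnn.
have [le_yt|lt_ty] := leqP y t.
  have [d td] : exists d, t = (y + d)%N by exists (t - y)%N; lia.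
  have [xE|xE] : (x = t \/ x = t.+1)%N by lia.
    by rewrite xE td; nia.
  by rewrite xE td; nia.
have [d yd] : exists d, y = (t + 1 + d)%N by exists (y - (t + 1))%N; lia.
have [xE|xE] : (x = t \/ x = t.+1)%N by lia.
  by rewrite xE yd; nia.
by rewrite xE yd; nia.
Qed.

Lemma near_const_eq (T x y : nat) : (x <= T <= x + 1)%N ->
  (x ^ 2 + (2 * T - 1) * y = y ^ 2 + (2 * T - 1) * x)%N ->
  (y <= T <= y + 1)%N.
Proof.
case: T => [|t] xT; first by (have -> : x = 0%N by lia) => /=; nia.
have -> : (2 * t.+1 - 1 = 2 * t + 1)%N by lia.
rewrite -!mulnn.
have [le_yt|lt_ty] := leqP y t.
  have [d td] : exists d, t = (y + d)%N by exists (t - y)%N; lia.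
  have [xE|xE] : (x = t \/ x = t.+1)%N by lia.
    by rewrite xE td => E; nia.
  by rewrite xE td => E; nia.
have [d yd] : exists d, y = (t + 1 + d)%N by exists (y - (t + 1))%N; lia.
have [xE|xE] : (x = t \/ x = t.+1)%N by lia.
  by rewrite xE yd => E; nia.
by rewrite xE yd => E; nia.
Qed.

(** Among nonnegative integer functions with a given sum and given values outside
    P, those that take only the values T and T - 1 on P minimise the sum of
    squares, and every minimiser has the same distribution of values. *)
Lemma sum_sqn_near_const (J : finType) (P : pred J) (f f' : J -> nat) (T : nat) :
  (forall j, ~~ P j -> f j = f' j) ->
  (forall j, P j -> (f j <= T <= f j + 1)%N) ->
  (\sum_j f j = \sum_j f' j)%N ->
  (\sum_j f j ^ 2 <= \sum_j f' j ^ 2)%N.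
Proof.
move=> fP fT sumf; pose k := (2 * T - 1)%N.
have : (\sum_j (f j ^ 2 + k * f' j) <= \sum_j (f' j ^ 2 + k * f j))%N.
  apply: leq_sum => j _; case: (boolP (P j)) => [/fT|/fP -> //].
  exact: near_const_leq.
by rewrite !big_split /= -!big_distrr /= sumf leq_add2r.
Qed.

Lemma sum_sqn_near_const_eq (V : pzRingType) (phi : nat -> V) (J : finType)
    (P : pred J) (f f' : J -> nat) (T : nat) :
  (forall j, ~~ P j -> f j = f' j) ->
  (forall j, P j -> (f j <= T <= f j + 1)%N) ->
  (\sum_j f j = \sum_j f' j)%N ->
  (\sum_j f j ^ 2 = \sum_j f' j ^ 2)%N ->
  \sum_j phi (f j) = \sum_j phi (f' j).
Proof.
move=> fP fT sumf sumf2; pose k := (2 * T - 1)%N.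
have E j : (f j ^ 2 + k * f' j = f' j ^ 2 + k * f j)%N.
  have lej i : (f i ^ 2 + k * f' i <= f' i ^ 2 + k * f i ?= iff
      (f i ^ 2 + k * f' i == f' i ^ 2 + k * f i))%N.
    split=> //; case: (boolP (P i)) => [/fT|/fP -> //].
    exact: near_const_leq.
  have [_] := leqif_sum (fun i (_ : true) => lej i).
  rewrite !big_split /= -!big_distrr /= sumf sumf2 eqxx => /esym/forallP/(_ j).
  by rewrite implyTb => /eqP.
have f'T j : P j -> (f' j <= T <= f' j + 1)%N.
  by move=> /fT fjT; apply: near_const_eq (E j).
pose d := phi T - phi T.-1.
have phiE j : phi (f j) + d * (f' j)%:R = phi (f' j) + d * (f j)%:R.
  case: (boolP (P j)) => [Pj|/fP -> //].
  have val2 x : (x <= T <= x + 1)%N -> phi x = phi T + d * x%:R - d * T%:R.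
    move=> xT; have [->|xE] : (x = T \/ T = x.+1)%N by lia.
      by rewrite addrK.
    by rewrite /d xE /= -natr1 mulrDr mulr1 opprD addrA addrK opprB addrC subrK.
  by rewrite (val2 _ (fT _ Pj)) (val2 _ (f'T _ Pj)) addrAC [RHS]addrAC; congr (_ - _);
     rewrite -!addrA [d * _ + _]addrC.
have : \sum_j (phi (f j) + d * (f' j)%:R) = \sum_j (phi (f' j) + d * (f j)%:R).
  exact: eq_bigr.
by rewrite !big_split /= -!mulr_sumr -!natr_sum sumf => /addIr.
Qed.

Section Coincidences.
Variables (S : finType) (N m : nat).
Implicit Type D : 'M[S]_(N, m).

Lemma coincidences_le D i i' : (coincidences D i i' <= m)%N.
Proof. by rewrite -[leqRHS]card_ord max_card. Qed.

Lemma coincidences_diag D i : coincidences D i i = m.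
Proof.
rewrite /coincidences -[RHS]card_ord -cardsT.
by apply: eq_card => k; rewrite !inE eqxx.
Qed.

Lemma sum_coincidences D : balanced D ->
  ((\sum_i \sum_i' coincidences D i i') * #|S| = m * N ^ 2)%N.
Proof.
move=> balD.
have -> : (\sum_i \sum_i' coincidences D i i' =
    \sum_(k < m) \sum_(i < N) #|[set i' | D i' k == D i k]|)%N.
  rewrite [RHS]exchange_big; apply: eq_bigr => i _ /=.
  under eq_bigr do rewrite /coincidences -sum1_card big_mkcond /=.
  rewrite exchange_big; apply: eq_bigr => k _ /=.
  rewrite -sum1_card [RHS]big_mkcond; apply: eq_bigr => i' _ /=.
  by rewrite !inE eq_sym.
rewrite big_distrl /=; under eq_bigr do rewrite big_distrl /=.
under eq_bigr do under eq_bigr do rewrite balD.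
by rewrite !sum_nat_const !card_ord.
Qed.

Section Contrasts.
Variables (R : realType) (c : 'I_(#|S|.-1) -> S -> R[i]).
Hypothesis hc : orthonormal_contrasts c.

Lemma gwp1_balanced D : (0 < #|S|)%N -> balanced D -> gwp c D 1 = 0.
Proof.
move=> S_gt0 balD; rewrite gwp_coincidences //.
under eq_bigr do under eq_bigr do rewrite kraw1 ?coincidences_le //.
have E : #|S|%:R * (\sum_i \sum_i' coincidences D i i')%:R = m%:R * N%:R ^+ 2 :> R[i].
  by rewrite -natrX -!natrM -(sum_coincidences balD) mulnC.
under eq_bigr do rewrite sumrB -mulr_sumr -natr_sum.
rewrite sumrB -mulr_sumr -natr_sum E !sumr_const !card_ord.
by rewrite -mulrnA -[m%:R *+ _]mulr_natr natrM expr2 subrr mulr0.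
Qed.

Lemma gwp2_coincidences D : gwp c D 2 *+ 2 =
  N%:R ^- 2 * (#|S|%:R ^+ 2 * (\sum_i \sum_i' coincidences D i i' ^ 2)%:R
    - (#|S|%:R * (2 * m%:R + #|S|%:R - 2)) * (\sum_i \sum_i' coincidences D i i')%:R
    + N%:R ^+ 2 * (m%:R ^+ 2 - m%:R)).
Proof.
rewrite gwp_coincidences // -mulrnAr; congr (_ * _).
set k2 := #|S|%:R * (2 * m%:R + #|S|%:R - 2).
have krawE i i' : kraw R[i] #|S| m (coincidences D i i') 2 *+ 2 =
    #|S|%:R ^+ 2 * (coincidences D i i' ^ 2)%:R - k2 * (coincidences D i i')%:R
    + (m%:R ^+ 2 - m%:R).
  by rewrite kraw2 ?coincidences_le // natrX /k2; ring.
transitivity (\sum_i \sum_i' kraw R[i] #|S| m (coincidences D i i') 2 *+ 2).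
  by rewrite -sumrMnl; apply: eq_bigr => i _; rewrite sumrMnl.
under [LHS]eq_bigr do under eq_bigr do rewrite krawE.
under [LHS]eq_bigr do rewrite big_split sumrB /= -!mulr_sumr -!natr_sum sumr_const card_ord.
rewrite [LHS]big_split sumrB /= -!mulr_sumr -!natr_sum sumr_const card_ord.
by rewrite -mulrnA -[_ *+ (N * N)]mulr_natl natrM expr2.
Qed.

Lemma near_const_GMA_optimal D (T : nat) : (0 < #|S|)%N -> balanced D ->
  (forall i i', i != i' -> (coincidences D i i' <= T <= coincidences D i i' + 1)%N) ->
  GMA_optimal c D.
Proof.
move=> S_gt0 balD DT [D' [r [[_ _ _ balD'] /andP[r_gt0 _] eqA ltA]]].
pose f (p : 'I_N * 'I_N) := coincidences D p.1 p.2.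
pose f' (p : 'I_N * 'I_N) := coincidences D' p.1 p.2.
pose P (p : 'I_N * 'I_N) := p.1 != p.2.
have fP p : ~~ P p -> f p = f' p.
  by rewrite negbK /f /f' => /eqP ->; rewrite !coincidences_diag.
have fT p : P p -> (f p <= T <= f p + 1)%N by exact: DT.
have S1 : (\sum_i \sum_i' coincidences D i i' = \sum_i \sum_i' coincidences D' i i')%N.
  by apply/eqP; rewrite -(eqn_pmul2r S_gt0) !sum_coincidences.
have sumf : (\sum_p f p = \sum_p f' p)%N by rewrite /f /f' -!pair_bigA.
have N_gt0 : (0 < N)%N.
  rewrite lt0n; apply: contraTneq ltA => N0.
  have N2 : N%:R ^- 2 = 0 :> R[i] by rewrite N0 expr0n invr0.
  by rewrite /gwp N2 !mul0r ltxx.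
have cst_gt0 : 0 < N%:R ^- 2 * #|S|%:R ^+ 2 :> R[i].
  by rewrite mulr_gt0 ?invr_gt0 ?exprn_gt0 ?ltr0n.
have le2 : (\sum_p f p ^ 2 <= \sum_p f' p ^ 2)%N by exact: sum_sqn_near_const fP fT sumf.
have gwp2B : (gwp c D' 2 - gwp c D 2) *+ 2 =
    N%:R ^- 2 * #|S|%:R ^+ 2 * ((\sum_p f' p ^ 2)%:R - (\sum_p f p ^ 2)%:R).
  rewrite mulrnBl !gwp2_coincidences S1 /f /f'.
  by rewrite -!(pair_bigA _ (fun i i' => coincidences _ i i' ^ 2)%N) /=; ring.
case: r r_gt0 eqA ltA => [//|[|[|r]]] _ eqA.
- by rewrite !gwp1_balanced ?ltxx.
- rewrite -subr_lt0 -(pmulrn_llt0 _ (isT : 0 < 2)%N) gwp2B pmulr_rlt0 // subr_lt0.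
  by rewrite ltr_nat ltnNge le2.
have sumf2 : (\sum_p f p ^ 2 = \sum_p f' p ^ 2)%N.
  apply/eqP; rewrite -(eqr_nat R[i]) eq_sym -subr_eq0 -(mulrI_eq0 _ (mulfI (lt0r_neq0 cst_gt0))).
  by rewrite -gwp2B (eqA 2) // subrr mul0rn.
rewrite !gwp_coincidences // !(pair_bigA _ (fun i i' => kraw _ _ _ (coincidences _ i i') _)) /=.
by rewrite (sum_sqn_near_const_eq (fun d => kraw R[i] #|S| m d r.+3) fP fT sumf sumf2) ltxx.
Qed.

End Contrasts.
End Coincidences.

(** * Normalised linear forms *)

Section LinearForms.
Variables (F : finFieldType) (n : nat).
Implicit Types (x y w c d : 'rV[F]_n) (P : {set 'rV[F]_n}).

(** The last nonzero coefficient of [c] is 1. *)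
Definition normalised c : bool :=
  [exists k : 'I_n, (c 0 k == 1) && [forall l : 'I_n, (k < l)%N ==> (c 0 l == 0)]].

(** The coefficient vectors of the linear forms in X_(j+1), ..., X_n. *)
Definition tail_coefs (j : nat) : {set 'rV[F]_n} :=
  [set c : 'rV[F]_n | [forall k : 'I_n, (k < j)%N ==> (c 0 k == 0)]].

(** The normalised ones; [lin_forms F n j] consists of their linear forms. *)
Definition norm_coefs (j : nat) : {set 'rV[F]_n} :=
  [set c in tail_coefs j | normalised c].

Lemma lin_formsE j : lin_forms F n j = [set linear_form c | c in norm_coefs j].
Proof.
rewrite /lin_forms; apply/setP => f; apply/imsetP/imsetP => -[c cP ->]; exists c => //.
  by move: cP; rewrite !inE.
by move: cP; rewrite !inE.
Qed.

Lemma linear_form_shift c x w mu :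
  linear_form c (x + mu *: w) = linear_form c x + mu * linear_form c w.
Proof.
rewrite !ffunE mulr_sumr -big_split; apply: eq_bigr => k _ /=.
by rewrite !mxE; ring.
Qed.

Lemma linear_form_shiftl c d x mu :
  linear_form (c + mu *: d) x = linear_form c x + mu * linear_form d x.
Proof.
rewrite !ffunE mulr_sumr -big_split; apply: eq_bigr => k _ /=.
by rewrite !mxE; ring.
Qed.

Lemma linear_formB c x y : linear_form c (x - y) = linear_form c x - linear_form c y.
Proof. by have := linear_form_shift c x y (-1); rewrite scaleN1r mulN1r. Qed.

Lemma linear_form_delta c k : linear_form c (delta_mx 0 k) = c 0 k.
Proof.
rewrite ffunE (bigD1 k) //= big1 => [|l lk]; rewrite !mxE !eqxx.
  by rewrite addr0 mulr1.
by rewrite (negbTE lk) mulr0.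
Qed.

Lemma linear_form_deltal d k : linear_form (delta_mx 0 k) d = d 0 k.
Proof.
rewrite ffunE (bigD1 k) //= big1 => [|l lk]; rewrite !mxE !eqxx.
  by rewrite addr0 mul1r.
by rewrite (negbTE lk) mul0r.
Qed.

Lemma linear_form_inj : injective (@linear_form F n).
Proof.
move=> c d cd; apply/rowP => k.
by rewrite -!linear_form_delta cd.
Qed.

(** A function that increases by mu under translation by mu w takes every value
    equally often on a set stable under these translations. *)
Lemma card_fibre_translation P (g : 'rV[F]_n -> F) w :
  (forall x mu, x \in P -> x + mu *: w \in P) ->
  (forall x mu, x \in P -> g (x + mu *: w) = g x + mu) ->
  forall q, (#|[set x in P | g x == q]| * #|F|)%N = #|P|.
Proof.
move=> Pw gw q.
have fibE q' : #|[set x in P | g x == q']| = #|[set x in P | g x == q]|.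
  have -> : [set x in P | g x == q'] =
      [set x + (q' - q) *: w | x in [set x in P | g x == q]].
    apply/setP => x; apply/idP/imsetP => [|[y]]; rewrite !inE => /andP[].
      move=> xP /eqP xq'; exists (x + (q - q') *: w).
        by rewrite !inE Pw // gw // xq' addrC subrK eqxx.
      by rewrite -addrA -scalerDl addrA subrK subrr scale0r addr0.
    by move=> yP /eqP yq ->; rewrite Pw // gw // yq addrC subrK eqxx.
  by rewrite card_imset //; apply: addIr.
rewrite -[RHS]sum1_card (partition_big g xpredT) //=.
under [RHS]eq_bigr => q' _.
  rewrite sum1_card (_ : #|_| = #|[set x in P | g x == q']|); last first.
    by apply: eq_card => x; rewrite !inE.
  rewrite fibE.
  over.
by rewrite sum_nat_const mulnC.
Qed.

Lemma normalised_scale c d (k : 'I_n) mu : d 0 k = 1 ->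
  (forall l : 'I_n, (k < l)%N -> d 0 l = 0) -> normalised c ->
  (forall l : 'I_n, (k <= l)%N -> d 0 l = mu * c 0 l) -> mu = 1.
Proof.
move=> dk dgt /existsP[k0 /andP[/eqP ck0 /forallP cgt]] dc.
have dckE : 1 = mu * c 0 k by rewrite -dc.
have [lt_kk0|lt_k0k|kk0] := ltngtP k k0.
- have := dgt _ lt_kk0; rewrite (dc _ (ltnW lt_kk0)) ck0 mulr1 => mu0.
  by move: dckE; rewrite mu0 mul0r => /eqP; rewrite oner_eq0.
- have /eqP ck : c 0 k == 0 by have := cgt k; rewrite lt_k0k.
  by move: dckE; rewrite ck mulr0 => /eqP; rewrite oner_eq0.
- by have kE : k = k0 := val_inj kk0; rewrite dckE kE ck0 mulr1.
Qed.

Lemma normalised_scaleI c d mu : normalised c -> normalised d -> d = mu *: c -> mu = 1.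
Proof.
move=> nc /existsP[k /andP[/eqP dk /forallP dgt]] dE.
apply: (normalised_scale dk _ nc) => l lk; last by rewrite dE mxE.
by apply/eqP; have := dgt l; rewrite lk.
Qed.

Lemma normalised_neq0 c : normalised c -> c != 0.
Proof.
move=> /existsP[k /andP[/eqP ck _]]; apply: contra_eq_neq ck => ->.
by rewrite mxE eq_sym oner_neq0.
Qed.

(** Every nonzero vector is a scalar multiple of a unique normalised one. *)
Lemma card_normalised P : 0 \in P ->
  (forall c mu, c \in P -> mu *: c \in P) ->
  ((#|F| - 1) * #|[set c in P | normalised c]| + 1)%N = #|P|.
Proof.
move=> P0 PZ; set Pn := [set c in P | normalised c].
pose U := [set mu : F | mu != 0].
have cardU : #|U| = (#|F| - 1)%N.
  by rewrite subn1 -(cardC1 (0 : F)); apply: eq_card => mu; rewrite !inE.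
have -> : P = 0 |: [set p.1 *: p.2 | p : F * 'rV[F]_n in setX U Pn].
  apply/setP => c; rewrite !inE; have [->|c0] := eqVneq c 0; first by rewrite P0.
  apply/idP/imsetP => [cP|[[mu d]]]; last first.
    by rewrite !inE /= => /andP[_ /andP[dP _]] ->; apply: PZ.
  have /existsP[k0 ck0] : [exists k, c 0 k != 0].
    apply: contraR c0; rewrite negb_exists => /forallP c0.
    by apply/eqP/rowP => k; have := c0 k; rewrite negbK mxE => /eqP.
  case: (@arg_maxnP _ k0 (fun k => c 0 k != 0) (fun k : 'I_n => k : nat) ck0) => k ck kmax.
  exists (c 0 k, (c 0 k)^-1 *: c); last by rewrite /= scalerA mulfV // scale1r.
  rewrite !inE ck PZ //=; apply/existsP; exists k.
  rewrite !mxE mulVf // eqxx; apply/forallP => l; apply/implyP => kl.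
  rewrite mxE; have [->|cl] := eqVneq (c 0 l) 0; first by rewrite mulr0.
  by have := kmax _ cl; rewrite /= leqNgt kl.
rewrite cardsU1 card_in_imset ?cardsX ?cardU.
  rewrite addnC; congr (_ + _)%N; apply/esym/eqP; rewrite eqb1.
  apply/imsetP => -[[mu d]]; rewrite !inE /= => /andP[mu0 /andP[_ /normalised_neq0 d0]].
  by move/eqP; rewrite eq_sym scaler_eq0 (negbTE mu0) (negbTE d0).
move=> [mu c] [nu d]; rewrite !inE /= => /andP[mu0 /andP[_ nc]] /andP[nu0 /andP[_ nd]] E.
have dE : d = (mu / nu) *: c by rewrite mulrC -scalerA E scalerA mulVf // scale1r.
have munu : mu / nu = 1 := normalised_scaleI nc nd dE.
by rewrite dE munu scale1r -[mu](divfK nu0) munu mul1r.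
Qed.

Lemma tail_coefs0 j : 0 \in tail_coefs j.
Proof. by rewrite inE; apply/forallP => k; rewrite mxE eqxx implybT. Qed.

Lemma tail_coefsZ j c mu : c \in tail_coefs j -> mu *: c \in tail_coefs j.
Proof.
rewrite !inE => /forallP cj; apply/forallP => k; apply/implyP => kj.
by have := cj k; rewrite kj mxE => /eqP ->; rewrite mulr0.
Qed.

Lemma card_norm_coefs j : ((#|F| - 1) * #|norm_coefs j| + 1)%N = #|tail_coefs j|.
Proof. exact: card_normalised (tail_coefs0 j) (@tail_coefsZ j). Qed.

(** The normalised coefficient vectors of the forms that vanish at [d]. *)
Definition norm_coefs_at j d : {set 'rV[F]_n} :=
  [set c in norm_coefs j | linear_form c d == 0].

Lemma card_norm_coefs_at j d :
  (exists2 k : 'I_n, (j <= k)%N & d 0 k != 0) ->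
  (((#|F| - 1) * #|norm_coefs_at j d| + 1) * #|F|)%N = #|tail_coefs j|.
Proof.
move=> [k jk dk].
pose P := [set c in tail_coefs j | linear_form c d == 0].
have -> : norm_coefs_at j d = [set c in P | normalised c].
  by apply/setP => c; rewrite !inE andbAC.
rewrite card_normalised; first last.
- move=> c mu /setIdP[cj /eqP cd]; apply/setIdP; split; first exact: tail_coefsZ.
  rewrite -[mu *: c]add0r linear_form_shiftl cd mulr0 addr0.
  by rewrite ffunE big1 // => l _; rewrite mxE mul0r.
- apply/setIdP; split; first exact: tail_coefs0.
  by rewrite ffunE big1 // => l _; rewrite mxE mul0r.
apply: (@card_fibre_translation _ (fun c => linear_form c d) ((d 0 k)^-1 *: delta_mx 0 k)).
  move=> c mu; rewrite !inE => /forallP cj; apply/forallP => l; apply/implyP => lj.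
  have := cj l; rewrite lj !mxE eqxx /= => /eqP ->.
  have -> : (l == k) = false by apply/negbTE; rewrite -val_eqE /= neq_ltn (leq_trans lj jk).
  by rewrite !mulr0 addr0.
by move=> c mu _; rewrite scalerA linear_form_shiftl linear_form_deltal divfK.
Qed.

(** Two vectors, the second not proportional to the first, are separated by a
    point, whose support can be taken inside the union of theirs. *)
Lemma separating_point c d : (forall mu, d != mu *: c) ->
  exists w, [/\ linear_form c w = 0, linear_form d w = 1 &
    forall k, c 0 k = 0 -> d 0 k = 0 -> w 0 k = 0].
Proof.
move=> dc.
have lin mu nu k l (v : 'rV[F]_n) :
    linear_form v (mu *: delta_mx 0 k + nu *: delta_mx 0 l) = mu * v 0 k + nu * v 0 l.
  by rewrite linear_form_shift -[_ *: delta_mx 0 k]add0r linear_form_shift !linear_form_delta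
    [linear_form v 0]ffunE big1 ?add0r // => i _; rewrite mxE mulr0.
have supp (mu nu : F) (k l i : 'I_n) : (k != i) -> (l != i) ->
    (mu *: delta_mx 0 k + nu *: delta_mx 0 l : 'rV[F]_n) 0 i = 0.
  move=> ki li; rewrite !mxE eqxx /= ![i == _]eq_sym (negbTE ki) (negbTE li).
  by rewrite !mulr0 addr0.
have nz (v : 'rV[F]_n) : v != 0 -> exists k, v 0 k != 0.
  move=> v0; apply/existsP; apply: contraR v0; rewrite negb_exists => /forallP v0.
  by apply/eqP/rowP => k; have := v0 k; rewrite negbK mxE => /eqP.
have [c0|/nz[k ck]] := eqVneq c 0.
  have /nz[l dl] : d != 0 by have := dc 0; rewrite scale0r.
  exists ((d 0 l)^-1 *: delta_mx 0 l + 0 *: delta_mx 0 l); split.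
  - by rewrite lin c0 !mxE !mulr0 addr0.
  - by rewrite lin mul0r addr0 mulVf.
  - by move=> i _ di; apply: supp; apply: contra_neq dl => ->.
have /nz[l] : d - (d 0 k / c 0 k) *: c != 0 by rewrite subr_eq0.
rewrite !mxE => el; set e := _ - _ in el.
exists (- (c 0 l / c 0 k) / e *: delta_mx 0 k + e^-1 *: delta_mx 0 l); split.
- by rewrite lin; field; rewrite ck el.
- have dl : d 0 l = e + d 0 k / c 0 k * c 0 l by rewrite /e subrK.
  by rewrite lin dl; move: (e) el => e' el; field; rewrite ck el.
- move=> i ci di; apply: supp; first by apply: contra_neq ck => ->.
  by apply: contra_neq el => li; rewrite /e li ci di mulr0 subr0.
Qed.

End LinearForms.

(** * The columns of the design *)

Section Columns.
Variables (F : finFieldType) (n : nat) (hn : (0 < n)%N).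
Implicit Types (x y c d w : 'rV[F]_n).
Let o : 'I_n := Ordinal hn.

Lemma X1E x : X1 F hn x = x 0 o. Proof. by rewrite ffunE. Qed.

(** The quadratic column X_1^2 + a X_1 + h, the form h having coefficients [c]. *)
Definition quad (a : F) c : {ffun 'rV[F]_n -> F} :=
  [ffun x => X1 F hn x ^+ 2 + a * X1 F hn x + linear_form c x].

Lemma quadE a c x : quad a c x = x 0 o ^+ 2 + a * x 0 o + linear_form c x.
Proof. by rewrite ffunE X1E. Qed.

Lemma tail_coefs1E c : (c \in tail_coefs F n 1) = (c 0 o == 0).
Proof.
rewrite inE; apply/forallP/eqP => [/(_ o)/=/eqP //|c0 k].
apply/implyP; rewrite ltnS leqn0 => /eqP k0; rewrite (_ : k = o) ?c0 //.
exact: val_inj.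
Qed.

Lemma norm_coefs1_o c : c \in norm_coefs F n 1 -> c 0 o = 0.
Proof. by case/setIdP; rewrite tail_coefs1E => /eqP. Qed.

Lemma norm_coefs1_pivot c : c \in norm_coefs F n 1 -> exists k : 'I_n,
  [/\ (0 < k)%N, c 0 k = 1 & forall l : 'I_n, (k < l)%N -> c 0 l = 0].
Proof.
move=> cA; have /setIdP[_ /existsP[k /andP[/eqP ck /forallP cgt]]] := cA.
exists k; split=> // [|l kl]; last by apply/eqP; have := cgt l; rewrite kl.
rewrite lt0n; apply/eqP => k0; have ko : k = o by exact: val_inj.
by move: ck; rewrite ko (norm_coefs1_o cA) => /eqP; rewrite eq_sym oner_eq0.
Qed.

Lemma tail_coefs0E c : c \in tail_coefs F n 0.
Proof. by rewrite inE; apply/forallP. Qed.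

Lemma card_points : #|{: 'rV[F]_n}| = (#|F| ^ n)%N.
Proof. by rewrite card_mx mul1n. Qed.

Lemma card_tail_coefs0 : #|tail_coefs F n 0| = (#|F| ^ n)%N.
Proof. by rewrite -card_points; apply: eq_card => c; rewrite tail_coefs0E. Qed.

(** A function that takes every value equally often. *)
Definition equidistributed (f : 'rV[F]_n -> F) : Prop :=
  forall q, (#|[set x | f x == q]| * #|F| = #|F| ^ n)%N.

Lemma equidistributed_translation (f : 'rV[F]_n -> F) w :
  (forall x mu, f (x + mu *: w) = f x + mu) -> equidistributed f.
Proof.
move=> fw q; rewrite -card_points.
transitivity #|[set: 'rV[F]_n]|; last by rewrite cardsT.
have := @card_fibre_translation F n [set: 'rV[F]_n] f w.
move=> /(_ (fun _ _ _ => in_setT _) (fun x mu _ => fw x mu) q) <-.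
by congr (_ * _)%N; apply: eq_card => x; rewrite !inE.
Qed.

Lemma card_tail_coefs1 : (#|tail_coefs F n 1| * #|F| = #|F| ^ n)%N.
Proof.
rewrite -(@equidistributed_translation (fun x => x 0 o) (delta_mx 0 o) _ 0).
  by congr (_ * _)%N; apply: eq_card => c; rewrite tail_coefs1E !inE.
by move=> x mu; rewrite !mxE !eqxx mulr1.
Qed.

Lemma quad_inj a b c d : c \in norm_coefs F n 1 -> d \in norm_coefs F n 1 ->
  quad a c = quad b d -> a = b /\ c = d.
Proof.
move=> /norm_coefs1_o c0 /norm_coefs1_o d0 E.
have Ek k : quad a c (delta_mx 0 k) = quad b d (delta_mx 0 k) by rewrite E.
split.
  have := Ek o; rewrite !quadE !linear_form_delta !mxE !eqxx c0 d0 !addr0 !mulr1.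
  exact: addrI.
apply/rowP => k; have [->|ko] := eqVneq k o; first by rewrite c0 d0.
have := Ek k; rewrite !quadE !linear_form_delta !mxE eqxx [o == k]eq_sym (negbTE ko).
by rewrite !mulr0 !addr0 => /addrI.
Qed.

Lemma sum_lin_forms (G : {ffun 'rV[F]_n -> F} -> nat) :
  (\sum_(i < #|lin_forms F n 0|) G (enum_val i) =
   \sum_(c in norm_coefs F n 0) G (linear_form c))%N.
Proof.
rewrite -(big_enum_val G) lin_formsE big_imset //.
by move=> c d _ _; apply: linear_form_inj.
Qed.

Lemma sum_Q1star (G : {ffun 'rV[F]_n -> F} -> nat) :
  (\sum_(i < #|Q1star F hn|) G (enum_val i) =
   \sum_(c in norm_coefs F n 1) \sum_a G (quad a c))%N.
Proof.
rewrite -(big_enum_val G).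
have -> : Q1star F hn = [set quad p.2 p.1 | p in setX (norm_coefs F n 1) setT].
  apply/setP => f; apply/imset2P/imsetP => [[a h _]|[[c a]]].
    rewrite lin_formsE => /imsetP[c cA ->] ->; exists (c, a) => //.
    by rewrite inE cA inE.
  rewrite !in_setX /= => /andP[cA _] ->.
  by exists a (linear_form c) => //; rewrite lin_formsE imset_f.
rewrite big_imset /=; last first.
  move=> [c a] [d b]; rewrite !in_setX /= => /andP[cA _] /andP[dA _] E.
  by have [-> ->] := quad_inj cA dA E.
rewrite pair_big /=; apply: eq_bigl => -[c a].
by rewrite in_setX in_setT.
Qed.

(** The function that column [k] of the design tabulates. *)
Definition column (k : 'I_(#|lin_forms F n 0| + #|Q1star F hn|)) :
    {ffun 'rV[F]_n -> F} :=
  match split k with inl i => enum_val i | inr j => enum_val j end.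

Lemma columnE i k : HQ_design F hn i k = column k (enum_val i).
Proof. by rewrite /column !mxE; case: split => j; rewrite mxE. Qed.

Lemma column_lshift i : column (lshift _ i) = enum_val i.
Proof. by rewrite /column (unsplitK (inl i)). Qed.

Lemma column_rshift i : column (rshift _ i) = enum_val i.
Proof. by rewrite /column (unsplitK (inr i)). Qed.

Lemma lin_column (i : 'I_#|lin_forms F n 0|) :
  exists2 c, c \in norm_coefs F n 0 & enum_val i = linear_form c.
Proof.
move: (enum_val i) (enum_valP i) => f; rewrite lin_formsE => /imsetP[c cA ->].
by exists c.
Qed.

Lemma quad_column (i : 'I_#|Q1star F hn|) :
  exists a c, c \in norm_coefs F n 1 /\ enum_val i = quad a c.
Proof.
move: (enum_val i) (enum_valP i) => f /imset2P[a h _]; rewrite lin_formsE => /imsetP[c cA ->] ->.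
by exists a, c.
Qed.

Lemma sum_columns (G : {ffun 'rV[F]_n -> F} -> nat) :
  (\sum_k G (column k) = \sum_(c in norm_coefs F n 0) G (linear_form c) +
   \sum_(c in norm_coefs F n 1) \sum_a G (quad a c))%N.
Proof.
rewrite big_split_ord /= -sum_lin_forms -sum_Q1star.
by congr (_ + _)%N; apply: eq_bigr => i _; rewrite (column_lshift, column_rshift).
Qed.

(** * Sizes, balance and coincidences of the design *)

Let s := #|F|.
Let A0 := norm_coefs F n 0.
Let A1 := norm_coefs F n 1.

Lemma card_norm_coefs1 : (((s - 1) * #|A1| + 1) * s = s ^ n)%N.
Proof. by rewrite card_norm_coefs card_tail_coefs1. Qed.

Lemma card_norm_coefs0 : (#|A0| = s * #|A1| + 1)%N.
Proof.
have s_gt1 : (1 < s)%N by exact: finNzRing_gt1.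
have := card_norm_coefs F n 0; rewrite card_tail_coefs0 -/s -card_norm_coefs1 -/A0.
by nia.
Qed.

Lemma card_columns : (#|lin_forms F n 0| + #|Q1star F hn| = 2 * #|A0| - 1)%N.
Proof.
transitivity (\sum_(k < #|lin_forms F n 0| + #|Q1star F hn|) 1)%N.
  by rewrite sum1_card card_ord.
have /= -> := sum_columns (fun _ => 1%N).
under [X in (_ + X)%N]eq_bigr do rewrite sum_nat_const.
rewrite !sum_nat_const !muln1 -/A0 -/A1 -/s card_norm_coefs0.
by move: #|_| => k; lia.
Qed.

Lemma size_HQ_design :
  (#|lin_forms F n 0| + #|Q1star F hn| = 2 * ((s ^ n - 1) %/ (s - 1)) - 1)%N.
Proof.
have s_gt1 : (1 < s)%N by exact: finNzRing_gt1.
rewrite card_columns; congr (2 * _ - 1)%N.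
have := card_norm_coefs F n 0; rewrite card_tail_coefs0 -/s -/A0 => <-.
by rewrite addnK mulKn // subn_gt0.
Qed.

(** A nonzero form increases by mu under translation by mu w, for a suitable w. *)
Lemma linear_form_translation c : c != 0 ->
  exists w, forall x mu, linear_form c (x + mu *: w) = linear_form c x + mu.
Proof.
move=> c0; have [|w [_ cw _]] := @separating_point F n 0 c.
  by move=> mu; rewrite scaler0.
by exists w => x mu; rewrite linear_form_shift cw mulr1.
Qed.

Lemma quad_translation a c w : w 0 o = 0 ->
  forall x mu, quad a c (x + mu *: w) = quad a c x + mu * linear_form c w.
Proof.
by move=> w0 x mu; rewrite !quadE linear_form_shift !mxE w0 mulr0 addr0 addrA.
Qed.

Lemma tail_form_translation c : c \in A1 -> exists2 w : 'rV[F]_n, w 0 o = 0 &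
  forall x mu, linear_form c (x + mu *: w) = linear_form c x + mu.
Proof.
move=> cA; have [|w [_ cw w0]] := @separating_point F n 0 c.
  by move=> mu; rewrite scaler0; move: cA => /setIdP[_ /normalised_neq0].
exists w; first by apply: w0; rewrite ?mxE ?norm_coefs1_o.
by move=> x mu; rewrite linear_form_shift cw mulr1.
Qed.

Lemma quad_column_translation a c : c \in A1 -> exists2 w : 'rV[F]_n, w 0 o = 0 &
  forall x mu, quad a c (x + mu *: w) = quad a c x + mu.
Proof.
move=> /tail_form_translation[w w0 cw]; exists w => // x mu.
by rewrite !quadE cw !mxE w0 mulr0 addr0 addrA.
Qed.

Lemma equidistributed_column k : equidistributed (column k).
Proof.
rewrite /column; case: split => i.
  have [c /setIdP[_ /normalised_neq0 /linear_form_translation[w cw]] ->] := lin_column i.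
  exact: equidistributed_translation cw.
have [a [c [cA ->]]] := quad_column i.
have [w _ qw] := quad_column_translation a cA.
exact: equidistributed_translation qw.
Qed.

(** Rows of the design are indexed through the enumeration of the points. *)
Lemma card_rows (P : pred 'rV[F]_n) :
  #|[set i : 'I_#|{: 'rV[F]_n}| | P (enum_val i)]| = #|[set x | P x]|.
Proof.
have -> : [set x | P x] = [set enum_val i | i in [set i : 'I_#|{: 'rV[F]_n}| | P (enum_val i)]].
  apply/setP => x; rewrite inE; apply/idP/imsetP => [Px|[k]]; last by rewrite inE => Pk ->.
  by exists (enum_rank x); rewrite ?inE enum_rankK.
by rewrite card_imset //; apply: enum_val_inj.
Qed.

Lemma balanced_HQ_design : balanced (HQ_design F hn).
Proof.
move=> k x; transitivity (#|F| ^ n)%N; last exact/esym/card_points.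
rewrite -(equidistributed_column k x) -(card_rows (fun y => column k y == x)).
by congr (_ * _)%N; apply: eq_card => i; rewrite !inE columnE.
Qed.

(** Two distinct points agree in 2 |A1| columns, or in one less when they have
    the same first coordinate, A1 being the set of normalised forms in the other
    variables. *)
Lemma coincidences_HQ_design (i i' : 'I_#|{: 'rV[F]_n}|) : i != i' ->
  (coincidences (HQ_design F hn) i i' +
    ((enum_val i : 'rV[F]_n) 0%R o == (enum_val i' : 'rV[F]_n) 0%R o) = 2 * #|A1|)%N.
Proof.
move=> ii'; set x : 'rV[F]_n := enum_val i; set y : 'rV[F]_n := enum_val i'.
have xy : x != y by apply: contra_neq ii'; apply: enum_val_inj.
have s_gt1 : (1 < s)%N by exact: finNzRing_gt1.
have -> : coincidences (HQ_design F hn) i i' = (\sum_k (column k x == column k y))%N.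
  rewrite /coincidences -sum1_card big_mkcond; apply: eq_bigr => k _.
  by rewrite inE !columnE; case: (_ == _).
rewrite (sum_columns (fun f => f x == f y : nat)).
have [k dk] : exists k, (x - y) 0 k != 0.
  apply/existsP; apply: contraR xy; rewrite negb_exists => /forallP d0.
  rewrite -subr_eq0; apply/eqP/rowP => k; have := d0 k.
  by rewrite negbK => /eqP ->; rewrite mxE.
have eqform c : (linear_form c x == linear_form c y) = (linear_form c (x - y) == 0).
  by rewrite linear_formB subr_eq0.
have sum_at j : (\sum_(c in norm_coefs F n j) (linear_form c x == linear_form c y) =
    #|norm_coefs_at j (x - y)|)%N.
  rewrite -sum1_card big_mkcond [RHS]big_mkcond; apply: eq_bigr => c _.
  by rewrite [c \in norm_coefs_at _ _]in_set -eqform; case: (_ \in _); case: (_ == _).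
rewrite sum_at.
have E0 : #|norm_coefs_at 0 (x - y)| = #|A1|.
  have := @card_norm_coefs_at F n 0 (x - y) (ex_intro2 _ _ k isT dk).
  by rewrite card_tail_coefs0 -/s -card_norm_coefs1; nia.
rewrite E0.
have [xyo|xyo] := eqVneq (x 0 o) (y 0 o).
  have -> : (\sum_(c in A1) \sum_a (quad a c x == quad a c y) =
      s * #|norm_coefs_at 1 (x - y)|)%N.
    rewrite -sum_at big_distrr /=; apply: eq_bigr => c _.
    under eq_bigr do rewrite !quadE xyo (inj_eq (addrI _)).
    by rewrite sum_nat_const.
  have k1 : (1 <= k)%N.
    rewrite lt0n; apply: contra_neq dk => k0.
    have -> : k = o by exact: val_inj.
    by rewrite !mxE xyo subrr.
  have := @card_norm_coefs_at F n 1 (x - y) (ex_intro2 _ _ k k1 dk).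
  by rewrite -/s -card_norm_coefs -/s -/A1; nia.
have -> : (\sum_(c in A1) \sum_a (quad a c x == quad a c y) = #|A1|)%N.
  rewrite -sum1_card; apply: eq_bigr => c _.
  (* The only a for which the two values agree. *)
  pose a0 := - ((x 0 o ^+ 2 - y 0 o ^+ 2 + linear_form c (x - y)) / (x 0 o - y 0 o)).
  have dxy : x 0 o - y 0 o != 0 by rewrite subr_eq0.
  rewrite (bigD1 a0) //= big1 => [|a /negbTE aa0].
    rewrite addn0 !quadE /a0 linear_formB; set u := x 0 o in dxy *; set v := y 0 o in dxy *.
    by apply/eqP; rewrite eqb1; apply/eqP; field.
  apply/eqP; rewrite eqb0 -subr_eq0 !quadE.
  have -> : x 0 o ^+ 2 + a * x 0 o + linear_form c x - (y 0 o ^+ 2 + a * y 0 o + linear_form c y)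
     = (a - a0) * (x 0 o - y 0 o).
    by rewrite /a0 linear_formB; set u := x 0 o in dxy *; set v := y 0 o in dxy *; field.
  by rewrite mulf_neq0 // subr_eq0 aa0.
by rewrite addn0 mul2n addnn.
Qed.

End Columns.
(** * Quadratic equations over a finite field *)

Section Roots.
Variable F : finFieldType.
Implicit Types b t u : F.

Lemma odd_card_field : odd #|F| = ((2 : F) != 0).
Proof.
have [p p_pr charFp] := finPcharP F.
have [k cardF] : exists k, #|F| = (p ^ k)%N by eexists; apply: card_pprimeChar charFp.
have k_neq0 : k != 0%N.
  by apply/eqP => k0; have := finNzRing_gt1 F; rewrite cardF k0.
rewrite cardF oddX (negbTE k_neq0) /= -(dvdn_pcharf charFp).
have [-> //|p_odd] := even_prime p_pr.
by rewrite dvdn_prime2 // p_odd; case: eqP p_odd => [->|].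
Qed.

(** The number of solutions t of t^2 + b t = u. *)
Definition num_roots b u : nat := #|[set t | t ^+ 2 + b * t == u]|.

Lemma num_rootsE b t : num_roots b (t ^+ 2 + b * t) = (t *+ 2 != - b).+1.
Proof.
(* The roots are t and - b - t, which coincide when 2 t = - b. *)
have -> : t *+ 2 != - b = (t != - b - t) by rewrite -subr_eq opprK -mulr2n.
rewrite -cards2; apply: eq_card => t'; rewrite !inE.
have factE : t' ^+ 2 + b * t' - (t ^+ 2 + b * t) = (t' - t) * (t' - (- b - t)) by ring.
rewrite -(subr_eq0 (_ + _)) factE mulf_eq0.
by rewrite subr_eq0 (subr_eq0 t' (- b - t)).
Qed.

Lemma num_rootsP b u :
  num_roots b u = 0%N \/ exists2 t, u = t ^+ 2 + b * t & num_roots b u = (t *+ 2 != - b).+1.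
Proof.
have [/eqP|[t]] := set_0Vmem [set t | t ^+ 2 + b * t == u].
  by rewrite -cards_eq0 => /eqP; left.
by rewrite inE => /eqP <-; right; exists t => //; apply: num_rootsE.
Qed.

Lemma num_roots_le2 b u : (num_roots b u <= 2)%N.
Proof. by have [->|[t _ ->]] := num_rootsP b u => //; case: (_ != _). Qed.

Lemma sum_num_roots b :
  (#|[set u | num_roots b u == 1] | + 2 * #|[set u | num_roots b u == 2]| = #|F|)%N.
Proof.
transitivity (\sum_u num_roots b u)%N.
  rewrite -!sum1_card big_distrr /= big_mkcond [X in (_ + X)%N]big_mkcond -big_split /=.
  apply: eq_bigr => u _; rewrite !inE; have := num_roots_le2 b u.
  by case: (num_roots b u) => [|[|[|]]].
rewrite -[RHS]sum1_card [RHS](partition_big (fun t => t ^+ 2 + b * t) xpredT) //=.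
by apply: eq_bigr => u _; rewrite sum1dep_card.
Qed.

Lemma num_roots1_odd b : odd #|F| -> #|[set u | num_roots b u == 1]| = 1%N.
Proof.
rewrite odd_card_field => two_neq0; pose t := - b / 2.
have tE t' : (t' *+ 2 == - b) = (t' == t).
  apply/eqP/eqP => [E|->]; first by rewrite /t -E -[t' *+ 2]mulr_natr mulfK.
  by rewrite -[t *+ 2]mulr_natr divfK.
apply/eqP/cards1P; exists (t ^+ 2 + b * t); apply/setP => u; rewrite !inE.
apply/eqP/eqP => [|->]; last by rewrite num_rootsE tE eqxx.
have [->//|[t' -> ->]] := num_rootsP b u.
by rewrite tE; case: (eqVneq t' t) => [->|].
Qed.

Lemma num_roots1_even b : ~~ odd #|F| -> b != 0 -> #|[set u | num_roots b u == 1]| = 0%N.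
Proof.
rewrite odd_card_field negbK => /eqP two0 b0.
apply/eqP; rewrite cards_eq0; apply/eqP/setP => u; rewrite !inE.
have [->//|[t _ ->]] := num_rootsP b u.
by rewrite -mulr_natr two0 mulr0 [0 == - b]eq_sym oppr_eq0 (negbTE b0).
Qed.

Lemma num_roots_sqr_even u : ~~ odd #|F| -> num_roots 0 u = 1%N.
Proof.
rewrite odd_card_field negbK => /eqP two0.
have sq_inj : injective (fun t : F => t ^+ 2).
  move=> t t' /eqP; rewrite -subr_eq0 subr_sqr mulf_eq0 subr_eq0 => /orP[/eqP //|].
  rewrite addr_eq0 => /eqP ->; apply/eqP; rewrite -subr_eq0 -opprD oppr_eq0 -mulr2n.
  by rewrite -mulr_natr two0 mulr0.
have [sq' _ sqK] := injF_bij sq_inj.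
have -> : u = sq' u ^+ 2 + 0 * sq' u by rewrite mul0r addr0 sqK.
by rewrite num_rootsE -mulr_natr two0 mulr0 oppr0 eqxx.
Qed.

End Roots.
(** * Joint distribution of two columns *)

Section Pairs.
Variables (F : finFieldType) (n : nat) (hn : (0 < n)%N).
Implicit Types (x y c d w : 'rV[F]_n) (f g : 'rV[F]_n -> F) (p : F * F).
Let o : 'I_n := Ordinal hn.
Let s := #|F|.

(** The number of points at which the pair of functions takes the value [p]. *)
Definition joint f g p : nat := #|[set x | (f x, g x) == p]|.

(** All pairs of values are taken equally often, s^n / s^2 times each. *)
Definition jointly_uniform f g : bool :=
  [forall p, joint f g p * s ^ 2 == s ^ n]%N.

(** The joint distribution of a semi-orthogonal pair: the frequencies are 0, 1 or 2
    times s^n / s^2, and the last two conditions give how often the factors 1 and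
    2 occur (for the latter, twice that number). *)
Definition semi_uniform f g : Prop :=
  [/\ forall p, exists2 r, (r <= 2)%N & (joint f g p * s ^ 2 = r * s ^ n)%N,
      #|[set p | joint f g p * s ^ 2 == s ^ n]%N| = (if odd s then s else 0%N)
    & (#|[set p | joint f g p * s ^ 2 == 2 * s ^ n]%N| * 2)%N =
        (if odd s then s * (s - 1) else s ^ 2)%N].

Lemma jointC f g p : joint f g p = joint g f (p.2, p.1).
Proof. by apply: eq_card => x; rewrite !inE -!pair_eqE /= andbC. Qed.

Lemma jointly_uniformP f g :
  reflect (forall p, (joint f g p * s ^ 2 = s ^ n)%N) (jointly_uniform f g).
Proof. by apply: (iffP forallP) => fg p; apply/eqP. Qed.

Lemma jointly_uniformC f g : jointly_uniform f g = jointly_uniform g f.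
Proof.
by apply/jointly_uniformP/jointly_uniformP => fg p; rewrite jointC.
Qed.

Lemma card_swap (P : pred (F * F)) : #|[set p | P (p.2, p.1)]| = #|[set p | P p]|.
Proof.
have swapK : involutive (fun p : F * F => (p.2, p.1)) by case.
rewrite -(card_imset _ (inv_inj swapK)); apply: eq_card => p; rewrite inE.
apply/imsetP/idP => [[q]|Pp]; first by rewrite inE => Pq ->.
by exists (p.2, p.1); rewrite ?inE -?surjective_pairing.
Qed.

Lemma semi_uniformC f g : semi_uniform f g -> semi_uniform g f.
Proof.
move=> [le2 n1 n2]; split=> [p||].
- by rewrite jointC.
- rewrite -n1 -[RHS](card_swap (fun p => joint f g p * s ^ 2 == s ^ n)%N).
  by apply: eq_card => p; rewrite !inE jointC.
- rewrite -n2 -[in RHS](card_swap (fun p => joint f g p * s ^ 2 == 2 * s ^ n)%N).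
  by congr (_ * _)%N; apply: eq_card => p; rewrite !inE jointC.
Qed.

Lemma card_field_gt1 : (1 < s)%N. Proof. exact: finNzRing_gt1. Qed.

Lemma semi_uniformN f g : semi_uniform f g -> ~~ jointly_uniform f g.
Proof.
have s_gt1 := card_field_gt1; clear o hn.
move=> [_ _ n2]; apply/jointly_uniformP => fg.
have : (0 < #|[set p | joint f g p * s ^ 2 == 2 * s ^ n]%N|)%N.
  by case: odd n2; nia.
move=> /card_gt0P[p]; rewrite inE fg => /eqP E.
have : (0 < s ^ n)%N by rewrite expn_gt0 ltnW.
lia.
Qed.

(** If a translation fixes [f] and moves [g] through all values, then each fibre
    of [f] is divided equally by the values of [g]. *)
Lemma jointly_uniform_translation f g w :
  equidistributed f -> (forall x mu, f (x + mu *: w) = f x) ->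
  (forall x mu, g (x + mu *: w) = g x + mu) -> jointly_uniform f g.
Proof.
move=> feq fw gw; apply/jointly_uniformP => -[q r].
rewrite expnS expn1 mulnA -(feq q); congr (_ * _)%N.
rewrite -(@card_fibre_translation F n [set x | f x == q] g w _ _ r).
- by congr (_ * _)%N; apply: eq_card => x; rewrite !inE -pair_eqE.
- by move=> x mu; rewrite !inE fw.
- by move=> x mu _; rewrite gw.
Qed.

Lemma linear_form_linear_form_uniform c d :
  c \in norm_coefs F n 0 -> d \in norm_coefs F n 0 -> c != d ->
  jointly_uniform (linear_form c) (linear_form d).
Proof.
move=> /setIdP[_ nc] /setIdP[_ nd] cd.
have [mu|w [cw dw _]] := @separating_point F n c d.
  by apply: contra_neq cd => dE; rewrite dE (normalised_scaleI nc nd dE) scale1r.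
have [v cv] := linear_form_translation (normalised_neq0 nc).
apply: (@jointly_uniform_translation _ _ w).
- exact: equidistributed_translation cv.
- by move=> x mu; rewrite linear_form_shift cw mulr0 addr0.
- by move=> x mu; rewrite linear_form_shift dw mulr1.
Qed.

Lemma quad_equidistributed a c : c \in norm_coefs F n 1 -> equidistributed (quad hn a c).
Proof.
move=> cA; have [w _ qw] := quad_column_translation hn a cA.
exact: equidistributed_translation qw.
Qed.

Lemma delta_norm_coefs : delta_mx 0 o \in norm_coefs F n 0.
Proof.
apply/setIdP; split; first exact: tail_coefs0E.
apply/existsP; exists o; rewrite mxE !eqxx; apply/forallP => l; apply/implyP => l0.
by rewrite mxE eqxx /= -val_eqE /= gtn_eqF.
Qed.

Lemma X1_uniform f w : w 0 o = 0 -> (forall x mu, f (x + mu *: w) = f x + mu) ->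
  jointly_uniform (linear_form (delta_mx 0 o)) f.
Proof.
move=> w0 fw; apply: (@jointly_uniform_translation _ _ w) => //.
  have /setIdP[_ /normalised_neq0/linear_form_translation[v]] := delta_norm_coefs.
  exact: equidistributed_translation.
by move=> x mu; rewrite !linear_form_deltal !mxE w0 mulr0 addr0.
Qed.

Lemma quad_quad_uniform a b c d :
  c \in norm_coefs F n 1 -> d \in norm_coefs F n 1 -> (a, c) != (b, d) ->
  jointly_uniform (quad hn a c) (quad hn b d).
Proof.
move=> cA dA acbd; have [co dO] := (norm_coefs1_o hn cA, norm_coefs1_o hn dA).
(* With the same form h, the pair determines X_1 and is determined by the first
   column and X_1. *)
have [cd|cd] := eqVneq c d.
  have ba : b - a != 0.
    by rewrite subr_eq0; apply: contra_neq acbd => ->; rewrite cd.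
  have [w w0 qw] := quad_column_translation hn a cA.
  have /jointly_uniformP qX :
      jointly_uniform (quad hn a c) (linear_form (delta_mx 0 o)).
    by rewrite jointly_uniformC; apply: X1_uniform w0 qw.
  apply/jointly_uniformP => -[p q]; rewrite -(qX (p, (q - p) / (b - a))).
  congr (_ * _)%N; apply: eq_card => x; rewrite !inE -!pair_eqE /=.
  case: eqP => //= <-; rewrite linear_form_deltal -[RHS](inj_eq (mulIf ba)) divfK //.
  rewrite -cd !quadE -[LHS]subr_eq0 -[RHS]subr_eq0; congr (_ == 0); ring.
have [mu|w [cw dw w0]] := @separating_point F n c d.
  apply: contra_neq cd => dE.
  have [/setIdP[_ nc] /setIdP[_ nd]] := (cA, dA).
  by rewrite dE (normalised_scaleI nc nd dE) scale1r.
have wo : w 0 o = 0 by exact: w0.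
apply: (@jointly_uniform_translation _ _ w).
- exact: quad_equidistributed.
- by move=> x mu; rewrite quad_translation // cw mulr0 addr0.
- by move=> x mu; rewrite quad_translation // dw mulr1.
Qed.

(** The linear form is c_1 X_1 + h, h being the linear part of the quadratic
    column in the other variables. *)
Definition aligned c d : bool := c == d + c 0 o *: delta_mx 0 o.

Lemma linear_form_quad_uniform a c d :
  c \in norm_coefs F n 0 -> d \in norm_coefs F n 1 -> ~~ aligned c d ->
  jointly_uniform (linear_form c) (quad hn a d).
Proof.
move=> cA dA ncd; have dO := norm_coefs1_o hn dA.
have [/setIdP[_ nc] /setIdP[_ nd]] := (cA, dA).
(* The part of the form in X_2, ..., X_n; it is not proportional to h. *)
pose c' := c - c 0 o *: delta_mx 0 o.
have c'o : c' 0 o = 0 by rewrite !mxE !eqxx mulr1 subrr.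
have [mu|w [c'w dw w0]] := @separating_point F n c' d.
  apply: contraNneq ncd => dE.
  have [k [k_gt0 dk dgt]] := norm_coefs1_pivot hn dA.
  (* Both forms end with the coefficient 1, at the same place. *)
  have mu1 : mu = 1.
    apply: (normalised_scale dk dgt nc) => l lk.
    rewrite dE !mxE eqxx /= (_ : (l == o) = false) ?mulr0 ?subr0 //.
    by apply/negbTE; rewrite -val_eqE /= -lt0n (leq_trans k_gt0 lk).
  by rewrite /aligned dE mu1 scale1r subrK.
have wo : w 0 o = 0 by apply: w0; rewrite ?c'o.
have cw : linear_form c w = 0.
  rewrite -[c](subrK (c 0 o *: delta_mx 0 o)) linear_form_shiftl -/c' c'w.
  by rewrite linear_form_deltal wo mulr0 addr0.
have [v cv] := linear_form_translation (normalised_neq0 nc).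
apply: (@jointly_uniform_translation _ _ w).
- exact: equidistributed_translation cv.
- by move=> x mu; rewrite linear_form_shift cw mulr0 addr0.
- by move=> x mu; rewrite quad_translation // dw mulr1.
Qed.

(** When the pair is aligned, the difference of the two columns is a quadratic in
    X_1 alone, while h is free. *)
Lemma joint_aligned a c d p : d \in norm_coefs F n 1 -> aligned c d ->
  (joint (linear_form c) (quad hn a d) p * s ^ 2 =
   num_roots (a - c 0 o)%R (p.2 - p.1)%R * s ^ n)%N.
Proof.
move=> dA /eqP cE; set co := c 0 o in cE *.
have [w w0 dw] := tail_form_translation hn dA.
have /jointly_uniformP Xd := X1_uniform w0 dw.
have lfc x : linear_form c x = linear_form d x + co * x 0 o.
  by rewrite cE linear_form_shiftl linear_form_deltal.
(* The points are sorted by their first coordinate t, which has to be a root;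
   then h takes the value p.1 - c_1 t. *)
pose X := linear_form (delta_mx 0 o : 'rV[F]_n).
pose T := [set t | t ^+ 2 + (a - co) * t == p.2 - p.1].
have -> : joint (linear_form c) (quad hn a d) p =
    (\sum_(t in T) joint X (linear_form d) (t, p.1 - co * t)%R)%N.
  rewrite /joint -sum1_card.
  rewrite (partition_big (fun x : 'rV[F]_n => x 0 o) (mem T)) /=.
    apply: eq_bigr => t; rewrite inE => /eqP tE.
    rewrite -sum1_card; apply: eq_bigl => x; rewrite !inE -!pair_eqE /=.
    rewrite linear_form_deltal quadE lfc andbC.
    case: (eqVneq (x 0 o) t) => //= ->.
    rewrite -[linear_form d x == _](inj_eq (addIr (co * t))) subrK.
    case: eqP => //= dE; have -> : linear_form d x = p.1 - co * t by rewrite -dE addrK.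
    have -> : p.2 = t ^+ 2 + (a - co) * t + p.1 by rewrite tE subrK.
    by apply/eqP; ring.
  move=> x; rewrite !inE -pair_eqE /= quadE lfc => /andP[/eqP <- /eqP <-].
  by apply/eqP; ring.
rewrite big_distrl /=; under eq_bigr do rewrite Xd.
by rewrite sum_nat_const.
Qed.

Lemma card_differences (P : pred F) :
  #|[set p : F * F | P (p.2 - p.1)]| = (s * #|[set u | P u]|)%N.
Proof.
have inj : injective (fun p : F * F => (p.1, p.2 + p.1)).
  by move=> [a b] [a' b'] [-> /addIr ->].
rewrite /s -[#|F|]cardsT -cardsX -[RHS](card_imset _ inj).
apply: eq_card => -[q r]; rewrite inE; apply/idP/imsetP => [Pqr|[[a b]]].
  by exists (q, r - q); rewrite ?in_setX ?inE //= subrK.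
by rewrite in_setX !inE /= => Pb [-> ->]; rewrite addrK.
Qed.

Lemma linear_form_quad_semi a c d : d \in norm_coefs F n 1 -> aligned c d ->
  odd s || (a != c 0 o) -> semi_uniform (linear_form c) (quad hn a d).
Proof.
move=> dA cd odd_or; pose b := a - c 0 o.
have sn_gt0 : (0 < s ^ n)%N by rewrite expn_gt0 ltnW ?card_field_gt1.
have jE p := joint_aligned a p dA cd.
have n1 r : #|[set p | joint (linear_form c) (quad hn a d) p * s ^ 2 == r * s ^ n]%N| =
    (s * #|[set u | num_roots b u == r]|)%N.
  rewrite -card_differences; apply: eq_card => p.
  by rewrite !inE jE eqn_pmul2r.
have := n1 1%N; rewrite mul1n => n1E.
have b_neq0 : ~~ odd s -> b != 0.
  by move=> /negbTE s_even; move: odd_or; rewrite s_even /b subr_eq0.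
have sumE := sum_num_roots b; rewrite -/s in sumE.
split=> [p||].
- by exists (num_roots b (p.2 - p.1)); rewrite ?num_roots_le2 ?jE.
- rewrite n1E; case: ifPn => [/num_roots1_odd ->|s_even]; first by rewrite muln1.
  by rewrite num_roots1_even ?muln0 ?b_neq0.
- rewrite n1; case: ifPn => [/num_roots1_odd Eb|s_even].
    by rewrite -mulnA [(_ * 2)%N]mulnC -sumE Eb addKn.
  by rewrite num_roots1_even ?b_neq0 // add0n in sumE; rewrite -mulnA [(_ * 2)%N]mulnC sumE.
Qed.

Lemma linear_form_quad_degenerate a c d : d \in norm_coefs F n 1 -> aligned c d ->
  ~~ (odd s || (a != c 0 o)) -> jointly_uniform (linear_form c) (quad hn a d).
Proof.
move=> dA cd; rewrite negb_or negbK => /andP[s_even /eqP ac].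
apply/jointly_uniformP => p.
by rewrite (joint_aligned _ _ dA cd) ac subrr num_roots_sqr_even // mul1n.
Qed.

Lemma linear_form_quad_uniformE a c d :
  c \in norm_coefs F n 0 -> d \in norm_coefs F n 1 ->
  jointly_uniform (linear_form c) (quad hn a d) =
  ~~ (aligned c d && (odd s || (a != c 0 o))).
Proof.
move=> cA dA; have [cd|cd] := boolP (aligned c d); last first.
  by rewrite linear_form_quad_uniform.
have [odd_or|even_eq] /= := boolP (_ || _).
  exact/negbTE/semi_uniformN/linear_form_quad_semi.
exact: linear_form_quad_degenerate.
Qed.

Lemma lin_columns_uniform (i j : 'I_#|lin_forms F n 0|) : i != j ->
  jointly_uniform (enum_val i) (enum_val j).
Proof.
move=> ij; have [[c cA ci] [d dA dj]] := (lin_column i, lin_column j).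
rewrite ci dj; apply: linear_form_linear_form_uniform => //.
by apply: contra_neq ij => cd; apply: enum_val_inj; rewrite ci dj cd.
Qed.

Lemma quad_columns_uniform (i j : 'I_#|Q1star F hn|) : i != j ->
  jointly_uniform (enum_val i) (enum_val j).
Proof.
move=> ij; have [[a [c [cA ci]]] [b [d [dA dj]]]] := (quad_column i, quad_column j).
rewrite ci dj; apply: quad_quad_uniform => //.
by apply: contra_neq ij => -[ab cd]; apply: enum_val_inj; rewrite ci dj ab cd.
Qed.

Lemma lin_quad_columns (i : 'I_#|lin_forms F n 0|) (j : 'I_#|Q1star F hn|) :
  jointly_uniform (enum_val i) (enum_val j) \/ semi_uniform (enum_val i) (enum_val j).
Proof.
have [[c cA ->] [a [d [dA ->]]]] := (lin_column i, quad_column j).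
have [/andP[cd odd_or]|nE] := boolP (aligned c d && (odd s || (a != c 0 o))).
  by right; apply: linear_form_quad_semi.
by left; rewrite linear_form_quad_uniformE.
Qed.

(** Every two columns are jointly uniform or have the joint distribution of a
    semi-orthogonal pair. *)
Lemma column_pair (k l : 'I_(#|lin_forms F n 0| + #|Q1star F hn|)) : k != l ->
  jointly_uniform (column k) (column l) \/ semi_uniform (column k) (column l).
Proof.
rewrite -(splitK k) -(splitK l); case: (split k) => i; case: (split l) => j /=;
  rewrite ?column_lshift ?column_rshift => kl.
- by left; apply: lin_columns_uniform; apply: contra_neq kl => ->.
- exact: lin_quad_columns.
- by rewrite jointly_uniformC; case: (lin_quad_columns j i) => [|/semi_uniformC]; [left|right].
- by left; apply: quad_columns_uniform; apply: contra_neq kl => ->.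
Qed.

End Pairs.

(** * Projected and overall A_2 *)

(** For a balanced design the projected A_2 of two columns is a function of the
    sum of squares of their joint frequencies. *)
Lemma projected_A2_occurrences (S : finType) (R : realType)
    (c : 'I_(#|S|.-1) -> S -> R[i]) (N m : nat) (D : 'M[S]_(N, m)) (k l : 'I_m) :
  orthonormal_contrasts c -> balanced D -> (0 < #|S|)%N -> (0 < N)%N ->
  projected_A2 c D k l =
    #|S|%:R ^+ 2 * (\sum_p occurrences D k l p ^ 2)%:R / N%:R ^+ 2 - 1.
Proof.
move=> hc balD S_gt0 N_gt0.
set E := row_mx (col k D) (col l D).
pose u (i i' : 'I_N) : nat := D i k == D i' k.
pose v (i i' : 'I_N) : nat := D i l == D i' l.
have coincE i i' : coincidences E i i' = (u i i' + v i i')%N.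
  rewrite /coincidences -sum1_card big_mkcond big_split_ord !big_ord1 /=.
  rewrite !inE !row_mxEl !row_mxEr !mxE /u /v.
  by case: (_ == _); case: (_ == _).
have balE : balanced E.
  move=> j x; rewrite -[RHS](balD (if (j < 1)%N then k else l) x); congr (_ * _)%N.
  apply: eq_card => i; rewrite !inE.
  by have [j' ->|j' ->] := split_ordP j; rewrite (row_mxEl, row_mxEr) mxE.
have S1 := sum_coincidences balE.
pose P := (\sum_p occurrences D k l p ^ 2)%N.
have uvE : (\sum_i \sum_i' u i i' * v i i' = P)%N.
  transitivity (\sum_i occurrences D k l (D i k, D i l))%N.
    apply: eq_bigr => i _; rewrite /occurrences -sum1_card [RHS]big_mkcond.
    apply: eq_bigr => i' _; rewrite inE -pair_eqE /= /u /v ![D i _ == _]eq_sym.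
    by case: (_ == _); case: (_ == _).
  rewrite (partition_big (fun i => (D i k, D i l)) xpredT) //=.
  apply: eq_bigr => p _; rewrite -mulnn /occurrences -[in RHS]sum1dep_card big_distrl /=.
  by apply: eq_bigr => i /eqP ->; rewrite mul1n sum1dep_card.
have S2 : (\sum_i \sum_i' coincidences E i i' ^ 2 =
    \sum_i \sum_i' coincidences E i i' + 2 * P)%N.
  rewrite -uvE big_distrr /= -big_split /=; apply: eq_bigr => i _.
  rewrite big_distrr /= -big_split /=; apply: eq_bigr => i' _.
  by rewrite coincE /u /v; case: (_ == _); case: (_ == _).
have two_neq0 : (2 : R[i]) != 0 by rewrite pnatr_eq0.
have S_neq0 : (#|S|%:R : R[i]) != 0 by rewrite pnatr_eq0 -lt0n.
have N_neq0 : (N%:R : R[i]) != 0 by rewrite pnatr_eq0 -lt0n.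
apply: (mulfI two_neq0); rewrite ![2 * _]mulr_natl /projected_A2 -/E.
rewrite (gwp2_coincidences hc E) S2 natrD natrM -/P.
have -> : (\sum_i \sum_i' coincidences E i i')%:R = 2 * N%:R ^+ 2 / #|S|%:R :> R[i].
  apply: (canRL (mulfK S_neq0)); rewrite -natrM S1.
  by rewrite natrM natrX.
by field; rewrite S_neq0 N_neq0.
Qed.

Section Design.
Variables (F : finFieldType) (n : nat) (hn : (0 < n)%N).
Let s := #|F|.
Let D := HQ_design F hn.

Section WordlengthOfDesign.
Variables (R : realType) (c : 'I_(#|F|.-1) -> F -> R[i]).
Hypothesis hc : orthonormal_contrasts c.

Lemma HQ_design_GMA_optimal : GMA_optimal c D.
Proof.
apply: (@near_const_GMA_optimal _ _ _ R c hc D (2 * #|norm_coefs F n 1|)).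
- exact: ltnW (card_field_gt1 F).
- exact: balanced_HQ_design.
- move=> i i' ii'; rewrite -(coincidences_HQ_design hn ii').
  by rewrite leq_addr leq_add2l leq_b1.
Qed.

Lemma gwp2_HQ_design : gwp c D 2 = s%:R ^+ n - s%:R.
Proof.
pose a := #|norm_coefs F n 1|.
pose b (i i' : 'I_#|{: 'rV[F]_n}|) : bool :=
  (enum_val i : 'rV[F]_n) 0 (Ordinal hn) == (enum_val i' : 'rV[F]_n) 0 (Ordinal hn).
set m := (#|lin_forms F n 0| + #|Q1star F hn|)%N.
set N := #|{: 'rV[F]_n}|.
have s_gt1 : (1 < s)%N := card_field_gt1 F.
have NE : N = (((s - 1) * a + 1) * s)%N by rewrite /N card_points card_norm_coefs1.
have mE : m = (2 * s * a + 1)%N.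
  by rewrite /m card_columns card_norm_coefs0 -/s -/a; lia.
pose K : R[i] := m%:R ^+ 2 - 4 * a%:R ^+ 2 + 4 * a%:R - 1.
have sqE i i' : (coincidences D i i' ^ 2)%:R =
    4 * a%:R ^+ 2 - (4 * a%:R - 1) * (b i i')%:R + (i == i')%:R * K :> R[i].
  have [->|ii'] := eqVneq i i'.
    by rewrite coincidences_diag -/m natrX /b eqxx /K /=; ring.
  have -> : (coincidences D i i' ^ 2)%:R = (2 * a%:R - (b i i')%:R) ^+ 2 :> R[i].
    by rewrite natrX -natrM -(coincidences_HQ_design hn ii') natrD addrK.
  by rewrite mul0r addr0; case: (b i i'); rewrite /=; ring.
have sumb i : (\sum_i' b i i' * s = N)%N.
  pose X := linear_form (delta_mx 0 (Ordinal hn) : 'rV[F]_n).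
  have /equidistributed_translation Xeq : forall x mu,
      X (x + mu *: delta_mx 0 (Ordinal hn)) = X x + mu.
    by move=> x mu; rewrite linear_form_shift linear_form_delta mxE !eqxx mulr1.
  transitivity (#|F| ^ n)%N; last by rewrite /N card_points.
  rewrite -(Xeq (X (enum_val i))) -big_distrl /=; congr (_ * _)%N.
  rewrite -(card_rows (fun x => X x == X (enum_val i))) -sum1_card [RHS]big_mkcond /=.
  by apply: eq_bigr => i' _; rewrite inE /X !linear_form_deltal eq_sym /b; case: (_ == _).
have S1 := sum_coincidences (@balanced_HQ_design F n hn).
have two_neq0 : (2 : R[i]) != 0 by rewrite pnatr_eq0.
have s_neq0 : (s%:R : R[i]) != 0 by rewrite pnatr_eq0 -lt0n ltnW.
have N_neq0 : (N%:R : R[i]) != 0.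
  by rewrite pnatr_eq0 -lt0n /N card_points expn_gt0 ltnW.
apply: (mulfI two_neq0); rewrite ![2 * _]mulr_natl (gwp2_coincidences hc D) -/s -/m -/N.
have -> : (\sum_i \sum_i' coincidences D i i')%:R = m%:R * N%:R ^+ 2 / s%:R :> R[i].
  by apply: (canRL (mulfK s_neq0)); rewrite -natrM S1 natrM natrX.
have -> : (\sum_i \sum_i' coincidences D i i' ^ 2)%:R =
    N%:R ^+ 2 * (4 * a%:R ^+ 2) - (4 * a%:R - 1) * (N%:R ^+ 2 / s%:R) + N%:R * K :> R[i].
  have sumbE i : (\sum_i' b i i')%:R = N%:R / s%:R :> R[i].
    by apply: (canRL (mulfK s_neq0)); rewrite -natrM big_distrl /= sumb.
  have rowE i : (\sum_i' coincidences D i i' ^ 2)%:R =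
      N%:R * (4 * a%:R ^+ 2) - (4 * a%:R - 1) * (N%:R / s%:R) + K :> R[i].
    rewrite natr_sum; under eq_bigr do rewrite sqE.
    rewrite big_split sumrB /= -[X in _ - X]mulr_sumr -natr_sum sumbE sumr_const card_ord.
    rewrite -[_ *+ #|_|]mulr_natl; congr (_ + _).
    rewrite (bigD1 i) //= eqxx mul1r big1 ?addr0 // => i' i'i.
    by rewrite eq_sym (negbTE i'i) mul0r.
  rewrite natr_sum; under eq_bigr do rewrite rowE.
  rewrite sumr_const card_ord -[_ *+ #|_|]mulr_natl -/N; ring.
have -> : s%:R ^+ n = N%:R :> R[i] by rewrite -natrX /N card_points.
rewrite -[_ *+ 2]mulr_natl.
have NE' : N%:R = ((s%:R - 1) * a%:R + 1) * s%:R :> R[i].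
  by rewrite NE natrM natrD natrM natrB // ltnW.
have Q_neq0 : (s%:R - 1) * a%:R + 1 != 0 :> R[i].
  by apply: contraNneq N_neq0 => Q0; rewrite NE' Q0 mul0r.
rewrite /K mE natrD !natrM NE'; field.
by rewrite s_neq0 Q_neq0.
Qed.

End WordlengthOfDesign.
End Design.
(** * Pairs of columns of the design *)

Section DesignPairs.
Variables (F : finFieldType) (n : nat) (hn : (0 < n)%N).
Implicit Types (f g : 'rV[F]_n -> F) (p : F * F).
Let s := #|F|.
Let D := HQ_design F hn.
Local Notation index := 'I_(#|lin_forms F n 0| + #|Q1star F hn|).
Implicit Types k l : index.

Let s_gt1 : (1 < s)%N := card_field_gt1 F.
Let s_gt0 : (0 < s)%N := ltnW s_gt1.

Lemma occurrencesE k l p : occurrences D k l p = joint (column k) (column l) p.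
Proof.
rewrite /occurrences /joint -(card_rows (fun x => (column k x, column l x) == p)).
by apply: eq_card => i; rewrite !inE !columnE.
Qed.

(** For n = 1 the s points cannot be spread evenly over s^2 pairs of values. *)
Lemma jointly_uniform_ngt1 f g : jointly_uniform f g -> (1 < n)%N.
Proof.
move=> /jointly_uniformP/(_ (0, 0)); rewrite -/s.
rewrite ltnNge => E; apply/negP => n_le1.
have sn : (s ^ n = s)%N by rewrite (_ : n = 1%N) ?expn1 //; lia.
have : (joint f g (0, 0)%R * s == 1)%N.
  by rewrite -(eqn_pmul2r s_gt0) mul1n -mulnA mulnn E sn.
by rewrite muln_eq1 (gtn_eqF s_gt1) andbF.
Qed.

Lemma semi_uniform_ngt1 f g : (2 < s)%N -> semi_uniform f g -> (1 < n)%N.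
Proof.
move=> s_gt2 [_ _ n2].
have /card_gt0P[p] : (0 < #|[set p | joint f g p * s ^ 2 == 2 * s ^ n]%N|)%N.
  by move: n2; rewrite -/s; case: odd; nia.
rewrite inE ltnNge => /eqP E; apply/negP => n_le1.
have sn : (s ^ n = s)%N by rewrite (_ : n = 1%N) ?expn1 //; lia.
have : (joint f g p * s == 2)%N.
  by rewrite -(eqn_pmul2r s_gt0) -mulnA mulnn E sn.
by case: (joint f g p) => [|j] //; rewrite mulSn; lia.
Qed.

Lemma joint_eq f g p r : (1 < n)%N ->
  (joint f g p * s ^ 2 == r * s ^ n)%N = (joint f g p == r * s ^ (n - 2))%N.
Proof.
move=> n_gt1; have -> : (s ^ n = s ^ (n - 2) * s ^ 2)%N by rewrite -expnD subnK.
rewrite mulnA eqn_pmul2r //.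
by rewrite expn_gt0 s_gt0.
Qed.

Lemma jointly_uniform_joint f g : (1 < n)%N -> jointly_uniform f g ->
  forall p, joint f g p = (s ^ (n - 2))%N.
Proof.
move=> n_gt1 /jointly_uniformP fg p; apply/eqP.
by have := joint_eq f g p 1 n_gt1; rewrite !mul1n fg eqxx.
Qed.

Lemma uniform_level_combinations k l : (1 < n)%N ->
  jointly_uniform (column k) (column l) -> level_combinations D k l = setT.
Proof.
move=> n_gt1 kl; apply/setP => p; rewrite !inE occurrencesE.
by rewrite (jointly_uniform_joint n_gt1 kl) expn_gt0 s_gt0.
Qed.

Lemma uniform_orthogonal k l :
  jointly_uniform (column k) (column l) -> orthogonal_cols D n k l.
Proof.
move=> kl; have n_gt1 := jointly_uniform_ngt1 kl.
rewrite /orthogonal_cols uniform_level_combinations // cardsT card_prod mulnn eqxx /=.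
by apply/forall_inP => p _; rewrite occurrencesE (jointly_uniform_joint n_gt1 kl).
Qed.

Lemma uniform_semi_orthogonalN k l :
  jointly_uniform (column k) (column l) -> ~~ semi_orthogonal D n k l.
Proof.
move=> kl; have n_gt1 := jointly_uniform_ngt1 kl.
rewrite /semi_orthogonal uniform_level_combinations // cardsT card_prod -/s.
have lt_half : (s ^ 2 %/ 2 < s * s)%N by rewrite -mulnn ltn_Pdiv // muln_gt0 s_gt0.
have lt_half1 : ((s + 1) * s %/ 2 < s * s)%N.
  by rewrite ltn_divLR //; have := s_gt1; nia.
by case: ifP => _; rewrite gtn_eqF.
Qed.

Lemma semi_uniform_semi_orthogonal k l : (2 < s)%N ->
  semi_uniform (column k) (column l) -> semi_orthogonal D n k l.
Proof.
move=> s_gt2 kl; have n_gt1 := semi_uniform_ngt1 s_gt2 kl.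
case: kl => le2 n1 n2; rewrite -/s in le2 n1 n2.
set f := column k in le2 n1 n2; set g := column l in le2 n1 n2.
have e_gt0 : (0 < s ^ (n - 2))%N by rewrite expn_gt0 s_gt0.
set e := (s ^ (n - 2))%N in e_gt0.
have joint1 p : (joint f g p * s ^ 2 == s ^ n)%N = (joint f g p == e).
  by have := joint_eq f g p 1 n_gt1; rewrite !mul1n.
have joint2 p : (joint f g p * s ^ 2 == 2 * s ^ n)%N = (joint f g p == 2 * e)%N.
  exact: joint_eq.
pose L1 := [set p | joint f g p == e]; pose L2 := [set p | joint f g p == 2 * e]%N.
have cardL1 : #|L1| = (if odd s then s else 0%N).
  by rewrite -n1; apply: eq_card => p; rewrite !inE joint1.
have cardL2 : (#|L2| * 2)%N = (if odd s then s * (s - 1) else s ^ 2)%N.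
  by rewrite -n2; congr (_ * _)%N; apply: eq_card => p; rewrite !inE joint2.
have LE : level_combinations D k l = L1 :|: L2.
  apply/setP => p; rewrite !inE occurrencesE -/f -/g.
  have [r r_le2 /eqP] := le2 p; rewrite joint_eq // -/e => /eqP ->.
  case: r r_le2 => [|[|[|]]] // _; rewrite ?mul0n ?mul1n ?eqxx ?orbT //.
    by rewrite ltnn !(eq_sym 0%N) muln_eq0 /= gtn_eqF.
  by rewrite muln_gt0 e_gt0.
have L12 : [disjoint L1 & L2].
  rewrite -setI_eq0; apply/eqP/setP => p; rewrite !inE.
  by case: eqP => //= ->; rewrite -[X in X == _]mul1n eqn_pmul2r.
have cardL : #|L1 :|: L2| = (#|L1| + #|L2|)%N by apply/eqP; rewrite (leq_card_setU L1 L2).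
have memL1 p : (p \in level_combinations D k l) && (occurrences D k l p == e) = (p \in L1).
  by rewrite LE occurrencesE !inE; case: (_ == e); rewrite ?andbF.
have memL2 p : (p \in level_combinations D k l) && (occurrences D k l p == 2 * e)%N = (p \in L2).
  by rewrite LE occurrencesE !inE -/f -/g; case: (_ == 2 * e)%N; rewrite ?orbT ?andbF.
rewrite /semi_orthogonal -/s; case: ifPn => s_par.
  rewrite s_par in cardL1 cardL2.
  apply/and3P; split.
  - rewrite LE cardL cardL1 eq_sym -(eqn_pmul2r (isT : 0 < 2)%N) divnK.
      by apply/eqP; nia.
    by rewrite dvdn2 oddM oddD s_par.
  - by rewrite -{2}cardL1; apply/eqP/eq_card => p; rewrite inE memL1.
  - rewrite -cardL2 mulnK //; apply/eqP/eq_card => p; rewrite inE memL2 //.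
rewrite (negbTE s_par) in cardL1 cardL2.
have L10 : L1 = set0 by apply/eqP; rewrite -cards_eq0 cardL1.
rewrite LE L10 set0U -cardL2 mulnK // eqxx /=.
by apply/forall_inP => p; rewrite inE occurrencesE.
Qed.

Lemma semi_orthogonalE k l : (2 < s)%N -> k != l ->
  semi_orthogonal D n k l = ~~ jointly_uniform (column k) (column l).
Proof.
move=> s_gt2 /column_pair[kl|kl].
  by rewrite kl; apply/negbTE/uniform_semi_orthogonalN.
by rewrite semi_uniform_semi_orthogonal // (semi_uniformN kl).
Qed.

(** All frequencies are at most 2 s^n / s^2, which is less than s^(n - 1). *)
Lemma not_fully_aliased k l : (2 < s)%N -> k != l -> ~~ fully_aliased D n k l.
Proof.
move=> s_gt2 kl; apply/negP => /andP[/eqP cardL /forall_inP occL].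
have /card_gt0P[p pL] : (0 < #|level_combinations D k l|)%N by rewrite cardL.
have {occL} := occL p pL; rewrite occurrencesE -/s => /eqP jE.
have sn : (s ^ n = s ^ (n - 1) * s)%N by rewrite -expnSr subn1 prednK.
have e_gt0 : (0 < s ^ (n - 1))%N by rewrite expn_gt0 s_gt0.
have : (joint (column k) (column l) p * s ^ 2 <= 2 * s ^ n)%N.
  have [/jointly_uniformP ->|[le2 _ _]] := column_pair kl.
    by rewrite leq_pmull.
  by have [r r_le2 ->] := le2 p; rewrite leq_mul2r r_le2 orbT.
rewrite jE sn expnS expn1; nia.
Qed.

Section ProjectedA2.
Variables (R : realType) (c : 'I_(#|F|.-1) -> F -> R[i]).
Hypothesis hc : orthonormal_contrasts c.

Lemma projected_A2_joint k l : projected_A2 c D k l =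
  (\sum_p (joint (column k) (column l) p * s ^ 2) ^ 2)%:R / (s%:R ^+ n * s%:R) ^+ 2 - 1.
Proof.
have s_neq0 : (s%:R : R[i]) != 0 by rewrite pnatr_eq0 -lt0n.
have NE : (#|{: 'rV[F]_n}|%:R : R[i]) = s%:R ^+ n by rewrite card_points natrX.
rewrite (projected_A2_occurrences k l hc (@balanced_HQ_design F n hn)) //; last first.
  by rewrite card_points expn_gt0 s_gt0.
rewrite NE -/s; congr (_ - 1).
under eq_bigr do rewrite occurrencesE.
under [in RHS]eq_bigr do rewrite expnMn.
rewrite -big_distrl /= natrM -expnM natrX; field.
by rewrite s_neq0 expf_neq0.
Qed.

Lemma uniform_projected_A2 k l :
  jointly_uniform (column k) (column l) -> projected_A2 c D k l = 0.
Proof.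
have s_neq0 : (s%:R : R[i]) != 0 by rewrite pnatr_eq0 -lt0n.
move=> /jointly_uniformP kl; rewrite projected_A2_joint.
under eq_bigr do rewrite kl.
rewrite sum_nat_const card_prod -/s !(natrM, natrX); field.
by rewrite s_neq0 expf_neq0.
Qed.

Lemma semi_projected_A2 k l : semi_uniform (column k) (column l) ->
  projected_A2 c D k l = if odd s then (s%:R - 1) / s%:R else 1.
Proof.
have s_neq0 : (s%:R : R[i]) != 0 by rewrite pnatr_eq0 -lt0n.
have sn_neq0 : (s%:R ^+ n : R[i]) != 0 by rewrite expf_neq0.
move=> [le2 n1 n2]; rewrite projected_A2_joint; rewrite -/s in le2 n1 n2.
have sn_gt0 : (0 < s ^ n)%N by rewrite expn_gt0 s_gt0.
have -> : (\sum_p (joint (column k) (column l) p * s ^ 2) ^ 2 =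
   (s ^ n) ^ 2 * (#|[set p | joint (column k) (column l) p * s ^ 2 == s ^ n]| +
    2 * (#|[set p | joint (column k) (column l) p * s ^ 2 == 2 * s ^ n]| * 2)))%N.
  rewrite [(_ * 2)%N in RHS]mulnC mulnA mulnDr -!sum1_card !big_distrr /=.
  rewrite [X in _ = (X + _)%N]big_mkcond [X in _ = (_ + X)%N]big_mkcond -big_split /=.
  apply: eq_bigr => p _; rewrite !inE; have [r r_le2 ->] := le2 p.
  have E1 : (r * s ^ n == s ^ n)%N = (r == 1%N).
    by rewrite -{2}(mul1n (s ^ n)%N) eqn_pmul2r.
  rewrite E1 eqn_pmul2r //.
  by case: r r_le2 {E1} => [|[|[|]]] //= _; lia.
rewrite n1 n2; case: ifP => _.
  by rewrite !(natrM, natrD, natrX) natrB //; field; rewrite s_neq0 sn_neq0.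
by rewrite add0n !(natrM, natrX); field; rewrite s_neq0 sn_neq0.
Qed.

End ProjectedA2.

(** Each form h and quadratic X_1^2 + a X_1 + h is aligned with the s forms
    t X_1 + h; the pair is semi-orthogonal unless s is even and t = a. *)
Lemma card_aligned (a : F) d : d \in norm_coefs F n 1 ->
  #|[set c in norm_coefs F n 0 |
      aligned hn c d && (odd s || (a != c 0 (Ordinal hn)))]| =
  (if odd s then s else s - 1)%N.
Proof.
set o := Ordinal hn => dA.
have d0 : d 0 o = 0 := norm_coefs1_o hn dA.
have shift_o (t : F) : (d + t *: delta_mx 0 o) 0 o = t.
  by rewrite !mxE !eqxx d0 mulr1 add0r.
pose T := [set t : F | odd s || (a != t)].
have -> : [set c in norm_coefs F n 0 | aligned hn c d && (odd s || (a != c 0 o))] =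
    [set d + t *: delta_mx 0 o | t in T].
  apply/setP => c; apply/setIdP/imsetP => [[_ /andP[/eqP cE acO]]|[t tT ->]].
    by exists (c 0 o); rewrite // inE.
  split; last by rewrite /aligned shift_o eqxx; move: tT; rewrite inE.
  apply/setIdP; split; first exact: tail_coefs0E.
  have [k [k_gt0 dk dgt]] := norm_coefs1_pivot hn dA.
  have off (l : 'I_n) : (0 < l)%N -> (d + t *: delta_mx 0 o) 0 l = d 0 l.
    move=> l_gt0; rewrite !mxE eqxx /= (_ : (l == o) = false) ?mulr0 ?addr0 //.
    by apply/negbTE; rewrite -val_eqE /= -lt0n.
  apply/existsP; exists k; rewrite off // dk eqxx; apply/forallP => l; apply/implyP => kl.
  by rewrite off ?(ltn_trans k_gt0 kl) // dgt.
rewrite card_imset; last by move=> t t' tt'; rewrite -(shift_o t) tt' shift_o.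
case: ifP => s_par; first by rewrite -[RHS]cardsT; apply: eq_card => t; rewrite !inE s_par.
rewrite subn1 -(cardC1 a); apply: eq_card => t.
by rewrite !inE s_par eq_sym.
Qed.

Lemma card_semi_orthogonal_pairs : (2 < s)%N ->
  #|semi_orthogonal_pairs D n| =
  (#|norm_coefs F n 1| * (s * (if odd s then s else s - 1)))%N.
Proof.
move=> s_gt2.
pose U (i : 'I_#|lin_forms F n 0|) (j : 'I_#|Q1star F hn|) : bool :=
  ~~ jointly_uniform (enum_val i) (enum_val j).
pose emb (q : 'I_#|lin_forms F n 0| * 'I_#|Q1star F hn|) : index * index :=
  (lshift _ q.1, rshift _ q.2).
have emb_inj : injective emb.
  move=> [i j] [i' j'] E.
  by have /lshift_inj/= -> := congr1 fst E; have /rshift_inj/= -> := congr1 snd E.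
have -> : semi_orthogonal_pairs D n = [set emb q | q in [set q | U q.1 q.2]].
  apply/setP => -[k l]; rewrite inE /=; apply/andP/imsetP => [[lt_kl]|[[i j]]].
    have kl : k != l by rewrite -val_eqE /= ltn_eqF.
    rewrite semi_orthogonalE //; move: lt_kl kl.
    rewrite -(splitK k) -(splitK l); case: (split k) => i; case: (split l) => j /=.
    - by move=> _ kl; rewrite !column_lshift lin_columns_uniform //; apply: contra_neq kl => ->.
    - by move=> _ _; rewrite column_lshift column_rshift => Uij; exists (i, j); rewrite ?inE.
    - by rewrite ltnNge (leq_trans (ltnW (ltn_ord j)) (leq_addr _ _)).
    - by move=> _ kl; rewrite !column_rshift quad_columns_uniform //; apply: contra_neq kl => ->.
  rewrite inE /U /= => Uij [-> ->]; split.
    by rewrite /= (leq_trans (ltn_ord i) (leq_addr _ _)).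
  rewrite semi_orthogonalE ?column_lshift ?column_rshift //.
  by rewrite -val_eqE /= ltn_eqF // (leq_trans (ltn_ord i) (leq_addr _ _)).
rewrite card_imset // -sum1_card big_mkcond /=.
under eq_bigr do rewrite inE.
rewrite -(pair_bigA _ (fun i j => if U i j then 1 else 0)%N) /=.
pose G (f : {ffun 'rV[F]_n -> F}) : nat :=
  (\sum_(d in norm_coefs F n 1) \sum_a (~~ jointly_uniform f (quad hn a d)))%N.
transitivity (\sum_(i < #|lin_forms F n 0|) G (enum_val i))%N.
  apply: eq_bigr => i _; rewrite /G.
  have /= <- := sum_Q1star hn
    (fun g : {ffun 'rV[F]_n -> F} => ~~ jointly_uniform (enum_val i) g : nat).
  by apply: eq_bigr => j _; rewrite /U; case: (jointly_uniform _ _).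
rewrite (sum_lin_forms G) /G exchange_big /= -sum_nat_const; apply: eq_bigr => d dA.
rewrite exchange_big /= -sum_nat_const; apply: eq_bigr => a _.
rewrite -(card_aligned a dA) -sum1_card [RHS]big_mkcond [LHS]big_mkcond /=.
apply: eq_bigr => c _; rewrite [X in _ = if X then _ else _]in_set.
case: (boolP (c \in norm_coefs F n 0)) => cA; last by [].
by rewrite linear_form_quad_uniformE //; case: (_ && _).
Qed.

(** The column X_1 is the linear form of coefficients (1, 0, ..., 0), which is
    aligned with no quadratic column. *)
Lemma X1_column : exists k1 : index,
  (forall i, D i k1 = X1 F hn (enum_val i)) /\
  forall k, k != k1 -> orthogonal_cols D n k1 k.
Proof.
pose o := Ordinal hn; pose e : 'rV[F]_n := delta_mx 0 o.
have eA : e \in norm_coefs F n 0 := delta_norm_coefs F hn.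
have eH : linear_form e \in lin_forms F n 0 by rewrite lin_formsE imset_f.
pose i1 := enum_rank_in eH (linear_form e).
have i1E : enum_val i1 = linear_form e := enum_rankK_in eH eH.
exists (lshift _ i1); split=> [i|k].
  by rewrite columnE column_lshift i1E linear_form_deltal X1E.
rewrite -(splitK k); case: (split k) => j /= kk1; apply: uniform_orthogonal;
  rewrite column_lshift i1E ?column_lshift ?column_rshift.
  by rewrite -i1E; apply: lin_columns_uniform; rewrite eq_sym; apply: contra_neq kk1 => ->.
have [a [d [dA ->]]] := quad_column j.
apply: linear_form_quad_uniform => //.
have /setIdP[_ /normalised_neq0] := dA; apply: contraNN => /eqP.
rewrite {2}/e mxE !eqxx scale1r -/e -[LHS]add0r => /addIr.
by move=> <-.
Qed.

End DesignPairs.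
(** * The optimal supersaturated design *)

Theorem theorem4 (R : realType) (s n : nat) (F : finFieldType)
    (hF : #|F| = s) (hs : (2 < s)%N) (hn : (0 < n)%N)
    (c : 'I_(#|F|.-1) -> F -> R[i]) (hc : orthonormal_contrasts c) :
  let D := HQ_design F hn in
  [/\ is_SSD (s ^ n) s (2 * ((s ^ n - 1) %/ (s - 1)) - 1) D,
      gwp c D 2 = s%:R ^+ n - s%:R,
      GMA_optimal c D,
      (exists k1, (forall i, D i k1 = X1 F hn (enum_val i)) /\
         forall k, k != k1 -> orthogonal_cols D n k1 k)
    & (forall k l, k != l -> ~~ fully_aliased D n k l)] /\
  (odd s ->
     [/\ forall k l, k != l ->
           projected_A2 c D k l = 0 \/
           projected_A2 c D k l = (s%:R - 1) / s%:R,
         #|semi_orthogonal_pairs D n| = ((s * (s ^ n - s)) %/ (s - 1))%N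
       & forall k l, k != l -> semi_orthogonal D n k l ->
           projected_A2 c D k l = (s%:R - 1) / s%:R]) /\
  (~~ odd s ->
     [/\ forall k l, k != l ->
           projected_A2 c D k l = 0 \/ projected_A2 c D k l = 1,
         #|semi_orthogonal_pairs D n| = (s ^ n - s)%N
       & forall k l, k != l -> semi_orthogonal D n k l ->
           projected_A2 c D k l = 1]).
Proof.
move=> D; subst s.
have s_gt0 : (0 < #|F| - 1)%N by lia.
have snE : (#|F| ^ n - #|F| = (#|F| - 1) * (#|norm_coefs F n 1| * #|F|))%N.
  by rewrite -(card_norm_coefs1 F hn) mulnDl mul1n addnK mulnA.
have proj k l (kl : k != l) : projected_A2 c D k l = 0 \/
    projected_A2 c D k l = if odd #|F| then (#|F|%:R - 1) / #|F|%:R else 1.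
  have [/(uniform_projected_A2 hc)|/(semi_projected_A2 hc)] := column_pair kl.
    by left.
  by right.
have semi_proj k l : k != l -> semi_orthogonal D n k l ->
    projected_A2 c D k l = if odd #|F| then (#|F|%:R - 1) / #|F|%:R else 1.
  move=> kl; rewrite semi_orthogonalE // => nkl.
  have [kl_unif|/(semi_projected_A2 hc) //] := column_pair kl.
  by rewrite kl_unif in nkl.
split; last split=> s_par.
- split.
  + split=> //; [exact: card_points | exact: size_HQ_design | exact: balanced_HQ_design].
  + exact: gwp2_HQ_design.
  + exact: HQ_design_GMA_optimal.
  + exact: X1_column.
  + by move=> k l; apply: not_fully_aliased.
- rewrite s_par in proj semi_proj; split=> //.
  rewrite card_semi_orthogonal_pairs // s_par snE.
  rewrite [(_ * ((_ - 1) * _))%N]mulnCA mulKn //.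
  by rewrite mulnCA.
- rewrite (negbTE s_par) in proj semi_proj; split=> //.
  by rewrite card_semi_orthogonal_pairs // (negbTE s_par) snE mulnA mulnC.
Qed.
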